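(* Let $p$ be a prime and let $Y$ be a connected space with finite fundamental group. Then the graded $\mathbb{Z}^\wedge_p$-algebra $H^*(Y;\mathbb{Z}^\wedge_p)$ is Noetherian if and only if the graded $\mathbb{F}_p$-algebra $H^*(Y;\mathbb{F}_p)$ is Noetherian and the torsion in $H^*(Y;\mathbb{Z}^\wedge_p)$ is bounded.
   Context: $\mathbb{Z}^\wedge_p$ denotes the ring of $p$-adic integers. $H^*(Y;R)$ denotes the cohomology of $Y$ with trivial coefficients in $R$, a graded-commutative $R$-algebra under cup product. Torsion in $H^*(Y;\mathbb{Z}^\wedge_p)$ means $p$-torsion: the graded submodule of elements annihilated by some power of $p$. It is bounded if there is a single integer $d\ge 0$ such that $p^d$ annihilates all torsion elements in all degrees. For $R=\mathbb{Z}^\wedge_p$ or $\mathbb{F}_p$ and $Y$ connected, $H^*(Y;R)$ is a Noetherian $R$-algebra if and only if it is finitely generated as an $R$-algebra. *)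

(* Defs.v *)
From HB Require Import structures.
From mathcomp Require Import all_boot all_order all_algebra.
From mathcomp Require Import generic_quotient ring_quotient.
From mathcomp Require Import all_classical reals topology normedtype.
From mathcomp Require Import continuous_path.
Import Order.TTheory GRing.Theory Num.Theory numFieldNormedType.Exports.

Set Implicit Arguments.
Unset Strict Implicit.
Unset Printing Implicit Defensive.

Local Open Scope classical_set_scope.
Local Open Scope ring_scope.
Local Open Scope quotient_scope.

Section Noetherian.
Variable A : pzRingType.
Implicit Types (I : set A) (s : seq A).

Definition left_ideal I :=
  [/\ I 0, forall x y, I x -> I y -> I (x + y) & forall a x, I x -> I (a * x)].

Definition left_span s : set A :=
  [set x | exists a : 'I_(size s) -> A, x = \sum_i a i * s`_i].

Definition left_noetherian :=
  forall I, left_ideal I -> exists s, I = left_span s.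
End Noetherian.

(* The right ideals of A are the left ideals of the converse ring A^c. *)
Definition noetherian (A : pzRingType) :=
  left_noetherian A /\ left_noetherian A^c.

Definition bounded_torsion (p : nat) (M : zmodType) :=
  exists d : nat, forall x : M,
    (exists k : nat, x *+ (p ^ k) = 0) -> x *+ (p ^ d) = 0.

(* The limit of the rings Z/p^n: the component of x in Z/p^n is represented   *)
(* by its least nonnegative residue x n, the condition padic_compat stating   *)
(* both that x n is reduced and that x n.+1 maps to x n.                      *)
Record padic (p : nat) := Padic {
  padic_val :> nat -> int;
  padic_compat : forall n, padic_val n = (padic_val n.+1 %% (p ^ n)%N)%Z }.

HB.instance Definition _ p := gen_eqMixin (padic p).
HB.instance Definition _ p := gen_choiceMixin (padic p).

Section PadicRing.
Variable p : nat.
Implicit Types (x y z : padic p) (m : int) (n : nat).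

Lemma padic_eq x y : (forall n, x n = y n) -> x = y.
Proof.
case: x y => [x xP] [y yP] /= /funext xy.
by move: xP; rewrite xy => xP; congr Padic; exact: Prop_irrelevance.
Qed.

Lemma modz_expS m n : ((m %% (p ^ n.+1)%N)%Z %% (p ^ n)%N)%Z = (m %% (p ^ n)%N)%Z.
Proof.
by rewrite [in RHS](divz_eq m (p ^ n.+1)%N) {3}expnS PoszM mulrA modzMDl.
Qed.

Lemma padic_mod x n : (x n %% (p ^ n)%N)%Z = x n.
Proof. by rewrite padic_compat modz_mod. Qed.

(* The element of Z_p with class f n in Z/p^n. *)
Definition padic_of (f : nat -> int)
    (fP : forall n, (f n = f n.+1 %[mod (p ^ n)%N])%Z) : padic p :=
  @Padic p (fun n => (f n %% (p ^ n)%N)%Z)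
    (fun n => etrans (fP n) (esym (modz_expS _ _))).

Lemma padicP x n : (x n = x n.+1 %[mod (p ^ n)%N])%Z.
Proof. by rewrite padic_mod -padic_compat. Qed.

Fact padic_cst_subproof m n : (m = m %[mod (p ^ n)%N])%Z.
Proof. by []. Qed.

Fact padic_add_subproof x y n :
  (x n + y n = x n.+1 + y n.+1 %[mod (p ^ n)%N])%Z.
Proof. by rewrite -modzDm !padicP modzDm. Qed.

Fact padic_opp_subproof x n : (- x n = - x n.+1 %[mod (p ^ n)%N])%Z.
Proof. by rewrite -modzNm padicP modzNm. Qed.

Fact padic_mul_subproof x y n :
  (x n * y n = x n.+1 * y n.+1 %[mod (p ^ n)%N])%Z.
Proof. by rewrite -modzMm !padicP modzMm. Qed.

Definition padic_cst m := padic_of (padic_cst_subproof m).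
Definition padic_add x y := padic_of (padic_add_subproof x y).
Definition padic_opp x := padic_of (padic_opp_subproof x).
Definition padic_mul x y := padic_of (padic_mul_subproof x y).

Fact padic_addA : associative padic_add.
Proof. by move=> x y z; apply: padic_eq => n /=; rewrite modzDml modzDmr addrA. Qed.

Fact padic_addC : commutative padic_add.
Proof. by move=> x y; apply: padic_eq => n /=; rewrite addrC. Qed.

Fact padic_add0 : left_id (padic_cst 0) padic_add.
Proof. by move=> x; apply: padic_eq => n /=; rewrite modzDml add0r padic_mod. Qed.

Fact padic_addN : left_inverse (padic_cst 0) padic_opp padic_add.
Proof. by move=> x; apply: padic_eq => n /=; rewrite modzDml addNr. Qed.

HB.instance Definition _ := GRing.isZmodule.Build (padic p)
  padic_addA padic_addC padic_add0 padic_addN.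

Fact padic_mulA : associative padic_mul.
Proof. by move=> x y z; apply: padic_eq => n /=; rewrite modzMml modzMmr mulrA. Qed.

Fact padic_mulC : commutative padic_mul.
Proof. by move=> x y; apply: padic_eq => n /=; rewrite mulrC. Qed.

Fact padic_mul1 : left_id (padic_cst 1) padic_mul.
Proof. by move=> x; apply: padic_eq => n /=; rewrite modzMml mul1r padic_mod. Qed.

Fact padic_mulDl : left_distributive padic_mul padic_add.
Proof.
by move=> x y z; apply: padic_eq => n /=; rewrite modzMml modzDm mulrDl.
Qed.

HB.instance Definition _ := GRing.Zmodule_isComPzRing.Build (padic p)
  padic_mulA padic_mulC padic_mul1 padic_mulDl.
End PadicRing.

Section Homotopy.
Variable R : realType.

Definition unit_interval : Type := set_type (`[0, 1]%classic : set R).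

HB.instance Definition _ := Topological.on unit_interval.

Fact unit_interval_in0 : (0 : R) \in (`[0, 1]%classic : set R).
Proof. by rewrite mem_setE in_itv /= lexx ler01. Qed.

Fact unit_interval_in1 : (1 : R) \in (`[0, 1]%classic : set R).
Proof. by rewrite mem_setE in_itv /= lexx ler01. Qed.

Fact unit_interval_neq :
  exist _ 0 unit_interval_in0 != exist _ 1 unit_interval_in1 :> unit_interval.
Proof. by apply/eqP => /(congr1 val) /= /esym/eqP; rewrite oner_eq0. Qed.

HB.instance Definition _ := isBiPointed.Build unit_interval unit_interval_neq.

Variable Y : topologicalType.

Definition path_connected :=
  forall x y : Y, $| {path unit_interval from x to y} |.

(* Homotopy relative to the endpoints. *)
Definition path_homotopic (x y : Y) (f g : {path unit_interval from x to y}) :=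
  exists2 H : unit_interval * unit_interval -> Y, continuous H &
    [/\ forall s, H (s, zero) = f s, forall s, H (s, one) = g s,
        forall t, H (zero, t) = x & forall t, H (one, t) = y].

(* The underlying set of the fundamental group: a loop class is encoded as    *)
(* the set of all the loops homotopic to a given one.                         *)
Definition fundamental_group (y : Y) :
    set (set {path unit_interval from y to y}) :=
  range (@path_homotopic y y).
End Homotopy.

Section SingularSimplices.
Variable R : realType.

Definition std_simplex n : set 'rV[R]_n.+1 :=
  [set t | (forall i, 0 <= t 0 i) /\ \sum_i t 0 i = 1].
Arguments std_simplex : clear implicits.

Section SimplexMap.
Variables (m n : nat) (th : 'I_m.+1 -> 'I_n.+1).

Fact simplex_map_subproof (t : std_simplex m) :
  \row_j \sum_(i | th i == j) \val t 0 i \in std_simplex n.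
Proof.
case: t => t /= /set_mem[t0 t1]; apply/mem_set; split=> [j|].
  by rewrite mxE sumr_ge0.
rewrite -[RHS]t1 [RHS](partition_big th xpredT) //=.
by apply: eq_bigr => j _; rewrite mxE.
Qed.

(* The affine map sending the i-th vertex of the standard m-simplex to the    *)
(* (th i)-th vertex of the standard n-simplex.                                *)
Definition simplex_map (t : std_simplex m) : std_simplex n :=
  exist (fun u => u \in std_simplex n) _ (simplex_map_subproof t).

Fact simplex_map_continuous : continuous simplex_map.
Proof.
apply: continuous_comp_initial => t A [P nP PA].
have cj i : continuous (fun t : std_simplex m => \val t 0 i).
  move=> u; apply: (@continuous_comp _ _ _ set_val (fun M : 'rV[R]_m.+1 => M 0 i)).
    exact: initial_continuous.
  exact: coord_continuous.
have cs j : continuous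
    (fun t : std_simplex m => \sum_(i | th i == j) \val t 0 i).
  by apply: continuous_big => [|i _]; [exact: add_continuous | exact: cj].
have : nbhs t [set s : std_simplex m |
    forall j, P 0 j (\sum_(i | th i == j) \val s 0 i)].
  apply: (@filter_forall _ _
    (fun j (s : std_simplex m) => P 0 j (\sum_(i | th i == j) \val s 0 i)) (nbhs t)) => j.
  apply: cs.
  by have := nP 0 j; rewrite /= mxE.
apply: filterS => s sP; apply: PA => i j; rewrite ord1 /= mxE; exact: sP.
Qed.

HB.instance Definition _ :=
  isContinuous.Build _ _ simplex_map simplex_map_continuous.
End SimplexMap.

Variable Y : topologicalType.

Definition singular n : Type := continuousType (std_simplex n) Y.

Definition pull m n (th : 'I_m.+1 -> 'I_n.+1) (s : singular n) : singular m :=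
  s \o simplex_map th.

Lemma pull_comp l m n (th : 'I_m.+1 -> 'I_n.+1) (ps : 'I_l.+1 -> 'I_m.+1) s :
  pull ps (pull th s) = pull (th \o ps) s.
Proof.
apply/continuousEP => t /=; congr (s _); apply: val_inj => /=.
apply/rowP => j; rewrite !mxE.
rewrite (partition_big ps (fun i => th i == j)) //=.
apply: eq_bigr => i /eqP ij; rewrite mxE; apply: eq_bigl => k.
by apply/eqP/andP => [->|[_ /eqP//]]; rewrite ij !eqxx.
Qed.

Lemma pull_id n (th : 'I_n.+1 -> 'I_n.+1) s : th =1 id -> pull th s = s.
Proof.
move=> thE; apply/continuousEP => t /=; congr (s _); apply: val_inj => /=.
apply/rowP => j; rewrite !mxE (eq_bigl (xpred1 j)) ?big_pred1_eq // => i.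
by rewrite thE.
Qed.

(* The face spanned by the vertices v_i, ..., v_(i + k). It is used only for  *)
(* i + k <= n.                                                                *)
Definition segment n i k (s : singular n) : singular k :=
  pull (fun j : 'I_k.+1 => inord (i + j)) s.

(* The face opposite to the j-th vertex. *)
Definition face n (j : 'I_n.+2) (s : singular n.+1) : singular n :=
  pull (lift j) s.
End SingularSimplices.

Section Cochains.
Variables (R : realType) (Y : topologicalType) (K : comPzRingType).

Local Notation sing n := (singular R Y n).

(* The direct sum over n of the groups of singular n-cochains. *)
Record cochains := Cochains {
  cochain_val :> forall n, sing n -> K;
  cochain_bounded :
    exists N, forall n, (N <= n)%N -> forall s : sing n, cochain_val s = 0 }.

HB.instance Definition _ := gen_eqMixin cochains.
HB.instance Definition _ := gen_choiceMixin cochains.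

Implicit Types a b c : cochains.

Lemma cochain_eq a b : (forall n (s : sing n), a n s = b n s) -> a = b.
Proof.
case: a b => [a aP] [b bP] /= ab.
have {}ab : a = b by apply: functional_extensionality_dep => n; apply/funext.
by move: aP; rewrite ab => aP; congr Cochains; exact: Prop_irrelevance.
Qed.

Fact cochain_zero_subproof :
  exists N, forall n, (N <= n)%N -> forall s : sing n, 0 = 0 :> K.
Proof. by exists 0%N. Qed.

Fact cochain_add_subproof a b :
  exists N, forall n, (N <= n)%N -> forall s : sing n, a n s + b n s = 0.
Proof.
have [[N aN] [M bM]] := (cochain_bounded a, cochain_bounded b).
exists (maxn N M) => n; rewrite geq_max => /andP[Nn Mn] s.
by rewrite aN // bM // addr0.
Qed.

Fact cochain_opp_subproof a :
  exists N, forall n, (N <= n)%N -> forall s : sing n, - a n s = 0.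
Proof.
by have [N aN] := cochain_bounded a; exists N => n Nn s; rewrite aN ?oppr0.
Qed.

Fact cochain_one_subproof : exists N, forall n, (N <= n)%N ->
  forall s : sing n, (n == 0)%N%:R = 0 :> K.
Proof. by exists 1%N => -[]. Qed.

(* The Alexander-Whitney formula. *)
Definition cup_fun a b n (s : sing n) : K :=
  \sum_(i < n.+1) a i (segment 0 i s) * b (n - i)%N (segment i (n - i) s).

Fact cup_subproof a b :
  exists N, forall n, (N <= n)%N -> forall s : sing n, cup_fun a b s = 0.
Proof.
have [[N aN] [M bM]] := (cochain_bounded a, cochain_bounded b).
exists (N + M)%N => n NMn s; apply: big1 => i _.
have [Ni|iN] := leqP N i; first by rewrite aN // mul0r.
rewrite bM ?mulr0 // leq_subRL; last by rewrite -ltnS.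
by rewrite (leq_trans _ NMn) // leq_add2r ltnW.
Qed.

Definition coboundary_fun a n : sing n -> K :=
  match n with
  | 0 => fun=> 0
  | m.+1 => fun s => \sum_(j < m.+2) (-1) ^+ j * a m (face j s)
  end.

Fact coboundary_subproof a :
  exists N, forall n, (N <= n)%N -> forall s : sing n, coboundary_fun a s = 0.
Proof.
have [N aN] := cochain_bounded a; exists N.+1 => -[//|n] /= Nn s.
by apply: big1 => j _; rewrite aN // mulr0.
Qed.

Definition cochain_zero := Cochains cochain_zero_subproof.
Definition cochain_add a b := Cochains (cochain_add_subproof a b).
Definition cochain_opp a := Cochains (cochain_opp_subproof a).
Definition cochain_one := Cochains cochain_one_subproof.
Definition cup a b := Cochains (cup_subproof a b).
Definition coboundary a := Cochains (coboundary_subproof a).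

Fact cochain_addA : associative cochain_add.
Proof. by move=> a b c; apply: cochain_eq => n s /=; rewrite addrA. Qed.

Fact cochain_addC : commutative cochain_add.
Proof. by move=> a b; apply: cochain_eq => n s /=; rewrite addrC. Qed.

Fact cochain_add0 : left_id cochain_zero cochain_add.
Proof. by move=> a; apply: cochain_eq => n s /=; rewrite add0r. Qed.

Fact cochain_addN : left_inverse cochain_zero cochain_opp cochain_add.
Proof. by move=> a; apply: cochain_eq => n s /=; rewrite addNr. Qed.

HB.instance Definition _ := GRing.isZmodule.Build cochains
  cochain_addA cochain_addC cochain_add0 cochain_addN.

Lemma cochain_cast a n k l (th : forall m, 'I_m.+1 -> 'I_n.+1) (s : sing n) :
  k = l -> a k (pull (th k) s) = a l (pull (th l) s).
Proof. by move->. Qed.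

Lemma segment_segment n i k j l (s : sing n) : (j + l <= k)%N -> (i + k <= n)%N ->
  segment j l (segment i k s) = segment (i + j) l s.
Proof.
move=> jlk ikn; rewrite /segment pull_comp; congr (pull _ s).
apply/funext => m /=; congr inord.
rewrite inordK ?addnA // ltnS (leq_trans _ jlk) // leq_add2l -ltnS //.
Qed.

Lemma segment_full n k (s : sing n) (a : cochains) :
  k = n -> a k (segment 0 k s) = a n s.
Proof.
by move->; rewrite /segment pull_id // => i /=; rewrite add0n inord_val.
Qed.

Fact cupA : associative cup.
Proof.
move=> a b c; apply: cochain_eq => n s /=; rewrite /cup_fun /=.
pose F k l m := a k (segment 0 k s) * b l (segment k l s) *
  c m (segment (k + l) m s).
transitivity (\sum_(k < n.+1) \sum_(l < (n - k).+1) F k l (n - k - l)%N).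
  apply: eq_bigr => k _; rewrite big_distrr /=; apply: eq_bigr => l _.
  have kn : (k <= n)%N by rewrite -ltnS.
  have ln : (l <= n - k)%N by rewrite -ltnS.
  rewrite mulrA /F !segment_segment ?subnKC ?addn0 ?add0n //.
transitivity (\sum_(i < n.+1) \sum_(k < i.+1) F k (i - k)%N (n - i)%N); last first.
  apply: eq_bigr => i _; rewrite big_distrl /=; apply: eq_bigr => k _.
  have li : (i <= n)%N by rewrite -ltnS.
  have ki : (k <= i)%N by rewrite -ltnS.
  by rewrite /F !segment_segment ?subnKC ?add0n // ltnW.
transitivity (\sum_(k < n.+1) \sum_(i < n.+1 | (k <= i)%N) F k (i - k)%N (n - i)%N).
  apply: eq_bigr => k _.
  have kn : (k <= n)%N by rewrite -ltnS.
  rewrite -(big_mkord xpredT (fun l => F k l (n - k - l)%N)).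
  rewrite -(big_mkord (fun i => k <= i)%N (fun i => F k (i - k)%N (n - i)%N)).
  rewrite [RHS](@big_cat_nat _ _ _ k) //= ?(leq_trans kn) //.
  rewrite [X in _ = X + _]big_nat_cond [X in _ = X + _]big_pred0; last first.
    by move=> i; case: (ltnP i k) => //; rewrite andbF.
  rewrite add0r -{4}[nat_of_ord k]add0n big_addn subSn //.
  apply: eq_big => [l|l _]; first by rewrite leq_addl.
  by rewrite addnK addnC subnDA.
rewrite (exchange_big_dep xpredT) //=; apply: eq_bigr => i _.
exact: (big_ord_narrow (ltn_ord i)).
Qed.

Fact cup1l : left_id cochain_one cup.
Proof.
move=> a; apply: cochain_eq => n s /=; rewrite /cup_fun big_ord_recl /=.
rewrite mul1r segment_full ?subn0 // big1 ?addr0 // => i _.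
by rewrite mul0r.
Qed.

Fact cup1r : right_id cochain_one cup.
Proof.
move=> a; apply: cochain_eq => n s /=; rewrite /cup_fun big_ord_recr /=.
rewrite subnn mulr1 segment_full // big1 ?add0r // => i _.
by rewrite -[(n - i)%N]prednK ?subn_gt0 //= mulr0.
Qed.

Fact cupDl : left_distributive cup cochain_add.
Proof.
move=> a b c; apply: cochain_eq => n s /=; rewrite /cup_fun -big_split /=.
by apply: eq_bigr => i _; rewrite mulrDl.
Qed.

Fact cupDr : right_distributive cup cochain_add.
Proof.
move=> a b c; apply: cochain_eq => n s /=; rewrite /cup_fun -big_split /=.
by apply: eq_bigr => i _; rewrite mulrDr.
Qed.

HB.instance Definition _ := GRing.Zmodule_isPzRing.Build cochains
  cupA cup1l cup1r cupDl cupDr.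

Lemma coboundaryB : {morph coboundary : a b / a - b}.
Proof.
move=> a b; apply: cochain_eq => -[|n] s /=; first by rewrite subr0.
rewrite -sumrN -big_split /=; apply: eq_bigr => j _.
by rewrite mulrDr mulrN.
Qed.

Lemma coboundary1 : coboundary 1 = 0.
Proof.
apply: cochain_eq => -[|[|n]] s //=.
  by rewrite !big_ord_recl big_ord0 /= expr0 expr1 !mulr1 addr0 subrr.
by apply: big1 => j _; rewrite mulr0.
Qed.

Fact cochain_sign_subproof a :
  exists N, forall n, (N <= n)%N -> forall s : sing n, (-1) ^+ n * a n s = 0.
Proof.
by have [N aN] := cochain_bounded a; exists N => n Nn s; rewrite aN ?mulr0.
Qed.

Definition cochain_sign a := Cochains (cochain_sign_subproof a).

Lemma cochain_signK : involutive cochain_sign.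
Proof. by move=> a; apply: cochain_eq => n s /=; rewrite signrMK. Qed.

Lemma coboundary_sign a : coboundary (cochain_sign a) = - cochain_sign (coboundary a).
Proof.
apply: cochain_eq => -[|n] s /=; first by rewrite mulr0 oppr0.
rewrite exprS mulN1r mulNr opprK big_distrr /=.
by apply: eq_bigr => j _; rewrite mulrCA.
Qed.

(* The three positions of the omitted vertex j relative to v_i, ..., v_(i+k). *)
Lemma segment_face_in n i k (s : sing n.+1) (j : 'I_n.+2) (j' : 'I_k.+2) :
  (i + k <= n)%N -> j = (i + j')%N :> nat ->
  segment i k (face j s) = face j' (segment i k.+1 s).
Proof.
move=> ikn jE; rewrite /segment /face !pull_comp; congr (pull _ s).
apply/funext => m; apply: val_inj => /=.
have imn : (i + m <= n)%N by rewrite (leq_trans _ ikn) // leq_add2l -ltnS.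
rewrite jE /bump [in LHS]inordK // leq_add2l addnCA inordK //.
by rewrite addnCA; case: (j' <= m)%N; rewrite ?add1n ?add0n ltnS // leqW.
Qed.

Lemma segment_face_gt n i k (s : sing n.+1) (j : 'I_n.+2) :
  (i + k < j)%N -> segment i k (face j s) = segment i k s.
Proof.
move=> ikj; rewrite /segment /face pull_comp; congr (pull _ s).
apply/funext => m; apply: val_inj => /=.
have mj : (i + m < j)%N by rewrite (leq_ltn_trans _ ikj) // leq_add2l -ltnS.
have imn : (i + m <= n)%N by rewrite -ltnS (leq_trans mj) // -ltnS.
by rewrite /bump !inordK // 1?leqW // leqNgt mj.
Qed.

Lemma segment_face_le n i k (s : sing n.+1) (j : 'I_n.+2) :
  (i + k <= n)%N -> (j <= i)%N -> segment i k (face j s) = segment i.+1 k s.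
Proof.
move=> ikn ji; rewrite /segment /face pull_comp; congr (pull _ s).
apply/funext => m; apply: val_inj => /=.
have imn : (i + m <= n)%N by rewrite (leq_trans _ ikn) // leq_add2l -ltnS.
by rewrite /bump !inordK // (leq_trans ji (leq_addr _ _)) add1n addSn.
Qed.

Lemma coboundary_cup a b :
  coboundary (a * b) = coboundary a * b + cochain_sign a * coboundary b.
Proof.
apply: cochain_eq => -[|n] s /=.
  by rewrite /cup_fun !big_ord_recl !big_ord0 /= mul0r mulr0 !addr0.
rewrite /cup_fun /=.
have -> : \sum_(i < n.+2) coboundary_fun a (segment 0 i s) *
      b (n.+1 - i)%N (segment i (n.+1 - i) s) =
    \sum_(i < n.+1) coboundary_fun a (segment 0 i.+1 s) *
      b (n - i)%N (segment i.+1 (n - i) s).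
  by rewrite big_ord_recl mul0r add0r; apply: eq_bigr.
have -> : \sum_(i < n.+2) (-1) ^+ i * a i (segment 0 i s) *
      coboundary_fun b (segment i (n.+1 - i) s) =
    \sum_(i < n.+1) (-1) ^+ i * a i (segment 0 i s) *
      coboundary_fun b (segment i (n - i).+1 s).
  rewrite big_ord_recr /= subnn mulr0 addr0; apply: eq_bigr => i _.
  by rewrite subSn // -ltnS.
rewrite -big_split /=.
under eq_bigr do rewrite big_distrr /=.
rewrite exchange_big /=; apply: eq_bigr => i _.
have iln : (i <= n)%N by rewrite -ltnS.
have si : segment i.+1 (n - i) s = face ord0 (segment i (n - i).+1 s).
  rewrite -(@segment_face_in _ _ _ _ (inord i)) ?subnKC ?inordK ?addn0 //.
    by rewrite segment_face_le ?subnKC ?inordK // ltnS leqW.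
  by rewrite ltnS leqW.
have s0 : segment 0 i s = face ord_max (segment 0 i.+1 s).
  rewrite -(@segment_face_in _ _ _ _ (inord i.+1)) ?add0n ?inordK //.
  by rewrite segment_face_gt // inordK.
rewrite [in RHS]big_ord_recr [X in _ + _ * X]big_ord_recl /= expr0 mul1r.
rewrite -si -s0 mulrDl mulrDr addrACA exprS mulN1r -mulrA mulNr.
rewrite mulNr -mulrA addrA addrK.
pose Q j := (-1) ^+ j * (a i (segment 0 i (face (inord j) s)) *
  b (n - i)%N (segment i (n - i) (face (inord j) s))).
transitivity (\sum_(0 <= j < n.+2) Q j).
  by rewrite big_mkord; apply: eq_bigr => j _; rewrite /Q inord_val.
rewrite (@big_cat_nat _ _ _ i.+1) //= ?ltnS ?leqW //; congr (_ + _).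
  rewrite big_mkord big_distrl /=; apply: eq_bigr => j _; rewrite /Q.
  have ji : (j <= i)%N by rewrite -ltnS.
  have jn : (inord j : 'I_n.+2) = j :> nat.
    by rewrite inordK // ltnS leqW // (leq_trans ji).
  rewrite (@segment_face_in _ 0 i _ _ (widen_ord (leqnSn i.+1) j)) //.
  by rewrite segment_face_le ?jn ?subnKC // mulrA.
rewrite -{1}[i.+1]add0n big_addn subSS subSn // big_mkord -mulrA big_distrr /=.
rewrite big_distrr /=; apply: eq_bigr => l _; rewrite /Q.
have jn : (inord (l + i.+1) : 'I_n.+2) = (l + i.+1)%N :> nat.
  by rewrite inordK // addnS !ltnS addnC -leq_subRL // -ltnS.
rewrite segment_face_gt ?jn ?add0n ?addnS ?ltnS ?leq_addl //.
rewrite (@segment_face_in _ i (n - i) _ _ (lift ord0 l)) ?subnKC //; last first.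
  by rewrite -addnS jn lift0 !addnS addnC.
rewrite [in RHS](mulrCA (a i _)) [RHS]mulrA -exprD.
by rewrite /bump /= add1n addnS [(i + l)%N]addnC.
Qed.
Definition cocycle : {pred cochains} := [pred c | coboundary c == 0].

Lemma cocycleP c : reflect (coboundary c = 0) (c \in cocycle).
Proof. exact: eqP. Qed.

Fact cocycle_subring_closed : subring_closed cocycle.
Proof.
split=> [|a b /cocycleP da /cocycleP db|a b /cocycleP da /cocycleP db].
- exact/cocycleP/coboundary1.
- by apply/cocycleP; rewrite coboundaryB da db subr0.
- by apply/cocycleP; rewrite coboundary_cup da db mul0r mulr0 addr0.
Qed.

Record cocycles := Cocycles { cocycle_val : cochains; _ : cocycle_val \in cocycle }.

HB.instance Definition _ := [isSub for cocycle_val].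
HB.instance Definition _ := [Choice of cocycles by <:].
HB.instance Definition _ := GRing.SubChoice_isSubPzRing.Build
  cochains cocycle cocycles cocycle_subring_closed.

Definition is_coboundary : {pred cocycles} :=
  [pred z | `[< exists b, val z = coboundary b >]].

Lemma is_coboundaryP z :
  reflect (exists b, val z = coboundary b) (z \in is_coboundary).
Proof. exact: asboolP. Qed.

Fact is_coboundary_zmod_closed : zmod_closed is_coboundary.
Proof.
split=> [|y z].
  apply/is_coboundaryP; exists 0; rewrite raddf0.
  by rewrite -[X in coboundary X](subrr 0) coboundaryB subrr.
move=> /is_coboundaryP[a ya] /is_coboundaryP[b zb]; apply/is_coboundaryP; exists (a - b).
by rewrite raddfB coboundaryB /= ya zb.
Qed.

HB.instance Definition _ :=
  GRing.isZmodClosed.Build cocycles is_coboundary is_coboundary_zmod_closed.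

Lemma is_coboundaryMl y z : z \in is_coboundary -> y * z \in is_coboundary.
Proof.
move=> /is_coboundaryP[b zb]; apply/is_coboundaryP; exists (cochain_sign (val y) * b).
have /cocycleP dy := valP y.
rewrite coboundary_cup coboundary_sign dy cochain_signK -zb rmorphM /=.
by rewrite (_ : cochain_sign 0 = 0) ?oppr0 ?mul0r ?add0r //;
  apply: cochain_eq => n s /=; rewrite mulr0.
Qed.

Lemma is_coboundaryMr y z : y \in is_coboundary -> y * z \in is_coboundary.
Proof.
move=> /is_coboundaryP[b yb]; apply/is_coboundaryP; exists (b * val z).
have /cocycleP dz := valP z.
by rewrite coboundary_cup dz mulr0 addr0 -yb rmorphM.
Qed.

(* Cocycles modulo coboundaries in the total complex, that is, the direct sum *)
(* over n of H^n(Y; K), with the ring structure given by the cup product.     *)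
Definition cohomology : Type := Quotient.quot is_coboundary.

HB.instance Definition _ := GRing.Zmodule.on cohomology.
HB.instance Definition _ := ZmodQuotient.on cohomology.

Definition cohomology_one : cohomology := \pi_cohomology 1.
Definition cohomology_mul (x y : cohomology) : cohomology :=
  \pi_cohomology (repr x * repr y).

Lemma cohomology_pi_eq y z :
  (\pi_cohomology y == \pi_cohomology z) = (y - z \in is_coboundary).
Proof. by rewrite (Quotient.idealrBE is_coboundary). Qed.

Lemma cohomology_piM :
  {morph \pi_cohomology : y z / y * z >-> cohomology_mul y z}.
Proof.
move=> y z; apply/eqP; rewrite /cohomology_mul cohomology_pi_eq.
set y' := repr _; set z' := repr _.
have -> : y * z - y' * z' = (y - y') * z + y' * (z - z').
  by rewrite mulrBl mulrBr addrA subrK.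
rewrite rpredD //.
  by apply: is_coboundaryMr; rewrite -cohomology_pi_eq reprK.
by apply: is_coboundaryMl; rewrite -cohomology_pi_eq reprK.
Qed.

Fact cohomology_mulA : associative cohomology_mul.
Proof.
move=> x y z; rewrite -[x]reprK -[y]reprK -[z]reprK.
rewrite -(cohomology_piM (repr y)) -(cohomology_piM (repr x) (repr y)).
by rewrite -!cohomology_piM mulrA.
Qed.

Fact cohomology_mul1l : left_id cohomology_one cohomology_mul.
Proof. by move=> x; rewrite -[x]reprK -cohomology_piM mul1r. Qed.

Fact cohomology_mul1r : right_id cohomology_one cohomology_mul.
Proof. by move=> x; rewrite -[x]reprK -cohomology_piM mulr1. Qed.

Fact cohomology_mulDl : left_distributive cohomology_mul +%R.
Proof.
move=> x y z; rewrite -[x]reprK -[y]reprK -[z]reprK.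
by rewrite -raddfD -!cohomology_piM mulrDl raddfD.
Qed.

Fact cohomology_mulDr : right_distributive cohomology_mul +%R.
Proof.
move=> x y z; rewrite -[x]reprK -[y]reprK -[z]reprK.
by rewrite -raddfD -!cohomology_piM mulrDr raddfD.
Qed.

HB.instance Definition _ := GRing.Zmodule_isPzRing.Build cohomology
  cohomology_mulA cohomology_mul1l cohomology_mul1r
  cohomology_mulDl cohomology_mulDr.
End Cochains.

Arguments path_connected : clear implicits.
Arguments fundamental_group R {Y} y.
Arguments cohomology : clear implicits.

(* Main.v *)
(* Write A = H(Y; Z_p), B = H(Y; F_p) and r : A -> B for the reduction.       *)
(* Reversing the vertices of simplices is an anti-automorphism of the         *)
(* cohomology ring, so only left ideals matter.                               *)
(* If A is noetherian, then its torsion is finitely generated, hence bounded; *)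
(* and a left ideal of B is finitely generated over A, since its preimage in  *)
(* A and its image under the Bockstein are left ideals of A.                  *)
(* Conversely, the reversal of vertices is homotopic to the identity up to    *)
(* sign, so B is commutative up to sign. If p^d kills the torsion of A, then  *)
(* x^(2p^d) lies in r(A) for all homogeneous x in B: if w lifts a cocycle and *)
(* dw = p^k v, then d(w^p) = p^(k+1) v' + p^k du for some v' and u. Hence B   *)
(* is a noetherian graded A-module: if B / (J + Bg) is noetherian, then so is *)
(* B / J, by Hilbert's argument applied to the g-adic filtration, where the   *)
(* chain of modules of leading coefficients has period 2p^d instead of 1. As  *)
(* A / pA embeds in B, the same argument for the p-adic filtration makes A    *)
(* graded noetherian, since its components are p-adically complete and, the   *)
(* torsion being bounded, separated. Leading forms remove the grading.        *)

Require Import Defs.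
From HB Require Import structures.
From mathcomp Require Import all_boot all_order all_algebra.
From mathcomp Require Import generic_quotient ring_quotient.
From mathcomp Require Import all_classical reals topology.
From mathcomp Require Import zify.
Import GRing.Theory.

Set Implicit Arguments.
Unset Strict Implicit.
Unset Printing Implicit Defensive.

Local Open Scope classical_set_scope.
Local Open Scope ring_scope.
Local Open Scope quotient_scope.

(** * Graded noetherian modules *)

(** Write [A] and [B] for the cohomology rings with coefficients in the p-adic integers and in
    ['F_p], and [r] for the reduction. The exact sequence of coefficients says that a class of [A]
    reducing to 0 is divisible by p ([ker_reduction]) and that a class of [B] with zero Bockstein
    comes from [A].

    From [A] to [B]: a left ideal of [B] is controlled by its preimage in [A] and its image under
    the Bockstein, two left ideals of [A] ([left_noetherian_bockstein]). The torsion is itself a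
    left ideal, so finitely many generators bound it ([bounded_torsion_noetherian]).

    From [B] to [A]: the key is [lift_power]. A p-th power of a class lifts modulo one more power of
    p, and once the obstruction is divisible enough the torsion bound removes it; so every
    homogeneous element of [B] has a power that comes from [A]. A periodic form of Hilbert's basis
    argument ([filtration_generators], [rel_noetherian_step]) then makes [B] a noetherian graded
    [A]-module ([rel_noetherian0]), hence so is [A / pA] ([rel_noetherian_mod]). The same argument
    for the powers of p, with completeness ([cohomology_complete]) and separatedness
    ([cohomology_separated]) in each degree, generates the graded left ideals of [A] finitely
    ([graded_ideal_generated]), and leading forms treat the others ([left_noetherian_graded]).

    Reversing simplices is an anti-automorphism of cohomology, so that left and right conditions
    agree ([noetherian_cohomology]). It is homotopic to the identity up to sign, which gives
    commutativity up to sign ([cohomology_commutative]). *)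

Section LeftSpan.
Variable A : pzRingType.
Implicit Types (s : seq A) (I : set A).

Lemma left_ideal_sum I n (f : 'I_n -> A) : left_ideal I ->
  (forall i, I (f i)) -> I (\sum_i f i).
Proof. by case=> I0 ID _ If; elim/big_ind: _. Qed.

Lemma left_span_ideal s : left_ideal (left_span s).
Proof.
split=> [|x y [a ->] [b ->]|c x [a ->]].
- by exists (fun=> 0); rewrite big1 // => i _; rewrite mul0r.
- exists (fun i => a i + b i); rewrite -big_split /=.
  by apply: eq_bigr => i _; rewrite mulrDl.
- exists (fun i => c * a i); rewrite big_distrr /=.
  by apply: eq_bigr => i _; rewrite mulrA.
Qed.

Lemma left_span_mem s x : x \in s -> left_span s x.
Proof.
move=> /(nthP 0)[i si <-]; exists (fun j => (j == Ordinal si)%:R).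
rewrite (bigD1 (Ordinal si)) //= eqxx mul1r big1 ?addr0 // => j /negPf ->.
by rewrite mul0r.
Qed.

Lemma left_span_min s I : left_ideal I -> {in s, forall x, I x} ->
  left_span s `<=` I.
Proof.
move=> II sI x [a ->]; apply: left_ideal_sum => // i.
by case: II => _ _; apply; apply/sI/mem_nth.
Qed.
End LeftSpan.

Section Submodules.
Variables (A B : pzRingType) (r : {rmorphism A -> B}).
Implicit Types (N J : set B) (s : seq B).

(** [A] acts on [B] on the left through [r]. For [r := idfun] these are the left ideals, so ideals
    and modules share the same lemmas. *)
Definition submod N :=
  [/\ N 0, forall x y, N x -> N y -> N (x + y) & forall a x, N x -> N (r a *
    x)].

Lemma submodN N x : submod N -> N x -> N (- x).
Proof. by case=> _ _ NM /(NM (-1)); rewrite rmorphN1 mulN1r. Qed.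

Lemma submodB N x y : submod N -> N x -> N y -> N (x - y).
Proof. by move=> NN Nx /(submodN NN); case: NN => _ ND _; apply: ND. Qed.

Lemma submod_sum N n (f : nat -> B) : submod N ->
  (forall i, (i < n)%N -> N (f i)) -> N (\sum_(i < n) f i).
Proof.
by case=> N0 ND _ Nf; elim/big_ind: _ => // i _; apply: Nf.
Qed.

(** Taken as an intersection of submodules: applying a membership proof to a predicate is induction
    over the span. *)
Definition mspan s : set B :=
  fun x => forall N, submod N -> {in s, forall y, N y} -> N x.

Lemma mspan_submod s : submod (mspan s).
Proof.
split=> [|x y sx sy|a x sx] N NN Ns.
- by case: NN.
- by have [_ ND _] := NN; apply: ND; [exact: sx | exact: sy].
- by have [_ _ NM] := NN; apply: NM; exact: sx.
Qed.

Lemma mspan_mem s x : x \in s -> mspan s x.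
Proof. by move=> sx N _; apply. Qed.

Lemma mspan_sub s s' : {subset s <= s'} -> mspan s `<=` mspan s'.
Proof.
by move=> ss x; apply; [exact: mspan_submod | move=> y /ss; exact: mspan_mem].
Qed.

Lemma mspan_cons u s x : mspan (u :: s) x -> exists a, mspan s (x - r a * u).
Proof.
have [s0 sD sM] := mspan_submod s.
move/(_ (fun x => exists a, mspan s (x - r a * u))); apply; first split.
- by exists 0; rewrite rmorph0 mul0r subrr.
- move=> y z [a ya] [b zb]; exists (a + b).
  by rewrite rmorphD mulrDl opprD addrACA; apply: sD.
- move=> c y [a ya]; exists (c * a).
  by rewrite rmorphM -mulrA -mulrBr; apply: sM.
- move=> y; rewrite inE => /predU1P[->|sy].
    by exists 1; rewrite rmorph1 mul1r subrr.
  by exists 0; rewrite rmorph0 mul0r subr0; apply: mspan_mem.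
Qed.
End Submodules.

(** * Rings graded by homogeneous projections *)

Record grading (A : pzRingType) := Grading {
  component :> nat -> A -> A;
  componentD : forall n, {morph component n : x y / x + y};
  component_component : forall m n x,
    component m (component n x) = if m == n then component n x else 0;
  component_sum : forall x, exists N, x = \sum_(n < N) component n x;
  componentM : forall n x y,
    component n (x * y) = \sum_(k < n.+1) component k x * component (n - k)%N y
      }.

Definition homogeneous (A : pzRingType) (c : grading A) x :=
  exists d, c d x = x.

Section GradingTheory.
Variables (A : pzRingType) (c : grading A).

Lemma component0 n : c n 0 = 0.
Proof. by apply: (addrI (c n 0)); rewrite -componentD !addr0. Qed.

Lemma componentN n x : c n (- x) = - c n x.
Proof. by apply: (addrI (c n x)); rewrite -componentD !subrr component0. Qed.

Lemma componentB n x y : c n (x - y) = c n x - c n y.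
Proof. by rewrite componentD componentN. Qed.

Lemma component_bigsum n I (s : seq I) (f : I -> A) :
  c n (\sum_(i <- s) f i) = \sum_(i <- s) c n (f i).
Proof. exact: (big_morph _ (componentD c n) (component0 n)). Qed.

Lemma componentMn n x k : c n (x *+ k) = c n x *+ k.
Proof.
by elim: k => [|k IH]; rewrite ?mulr0n ?component0 // !mulrSr componentD IH.
Qed.

Lemma component_homog m d x : c d x = x -> c m x = if m == d then x else 0.
Proof. by move=> xd; rewrite -[in LHS]xd component_component xd. Qed.

Lemma componentM_homogr n d x y : c d y = y ->
  c n (x * y) = if (d <= n)%N then c (n - d)%N x * y else 0.
Proof.
move=> yd; rewrite componentM; case: leqP => [dn|nd].
  have ln : (n - d < n.+1)%N by rewrite ltnS leq_subr.
  rewrite (bigD1 (Ordinal ln)) //= subKn // yd big1 ?addr0 // => k kn.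
  rewrite (component_homog _ yd) ifN ?mulr0 //.
  apply: contra kn => /eqP kd; apply/eqP/val_inj => /=.
  by rewrite -kd subKn // -ltnS.
apply: big1 => k _; rewrite (component_homog _ yd) ifN ?mulr0 //.
by rewrite neq_ltn (leq_ltn_trans _ nd) // leq_subr.
Qed.

Lemma componentM_homogl n d x y : c d x = x ->
  c n (x * y) = if (d <= n)%N then x * c (n - d)%N y else 0.
Proof.
move=> xd; rewrite componentM; case: leqP => [dn|nd].
  have ln : (d < n.+1)%N by [].
  rewrite (bigD1 (Ordinal ln)) //= xd big1 ?addr0 // => k kn.
  by rewrite (component_homog _ xd) ifN ?mul0r.
apply: big1 => k _; rewrite (component_homog _ xd) ifN ?mul0r //.
by rewrite neq_ltn (leq_ltn_trans _ nd) // -ltnS.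
Qed.

(** Comparing degree [k] parts in [c k 1 * 1 = c k 1] gives [c k 1 * c 0 1 = c k 1]; summing over
    [k] yields [c 0 1 = 1]. *)
Lemma component_one n : c n 1 = if n == 0%N then 1 else 0.
Proof.
have [N] := component_sum c 1.
have c0 k : c k 1 * c 0%N 1 = c k 1.
  have -> : c k 1 * c 0%N 1 = c k (c k 1 * c 0%N 1).
    have h : c 0%N (c 0%N 1) = c 0%N 1 by rewrite component_component eqxx.
    by rewrite (componentM_homogr _ _ h) /= subn0 component_component eqxx.
  transitivity (c k (c k 1 * 1));
    last by rewrite mulr1 component_component eqxx.
  have h : c k (c k 1) = c k 1 by rewrite component_component eqxx.
  by rewrite !(componentM_homogl _ _ h) leqnn subnn component_component eqxx.
move=> e1; have c01 : c 0%N 1 = 1.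
  rewrite [RHS]e1; under eq_bigr => i _ do rewrite -c0.
  by rewrite -big_distrl /= -e1 mul1r.
by rewrite (component_homog _ c01).
Qed.

Lemma component_exp d x k : c d x = x -> c (k * d)%N (x ^+ k) = x ^+ k.
Proof.
move=> xd; elim: k => [|k IH]; first by rewrite mul0n expr0 component_one.
by rewrite exprS (componentM_homogl _ _ xd) mulSn leq_addr addKn IH.
Qed.
End GradingTheory.

(** * Noetherianity of graded quotient modules *)

Section GradedNoetherian.
Variables (A B : pzRingType) (r : {rmorphism A -> B}).
Variables (cA : grading A) (cB : grading B).
Hypothesis rc : forall n a, r (cA n a) = cB n (r a).
Implicit Types (N J : set B) (s : seq B).

Definition graded N := forall n x, N x -> N (cB n x).

(* Noetherianity of the graded A-module B / J. *)
Definition rel_noetherian J := forall N, submod r N -> graded N -> J `<=` N ->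
  exists2 s, {in s, forall y, N y} &
    forall x, N x -> exists2 j, J j & mspan r s (x - j).

Lemma component_act n a x :
  cB n (r a * x) = \sum_(k < n.+1) r (cA k a) * cB (n - k)%N x.
Proof. by rewrite componentM; apply: eq_bigr => k _; rewrite rc. Qed.

Lemma mspan_graded s : {in s, forall y, homogeneous cB y} -> graded (mspan r s).
Proof.
have sS := mspan_submod r s; have [s0 sD sM] := sS.
move=> sH n x sx; move: n.
apply: (sx (fun x => forall n, mspan r s (cB n x))); first split.
- by move=> n; rewrite component0.
- by move=> y z sy sz n; rewrite componentD; apply: sD.
- move=> a y sy n; rewrite component_act.
  by apply: (submod_sum (f := fun k => r (cA k a) * cB (n - k)%N y) sS) => k _;
    apply: sM.
- move=> y sy n; have [d yd] := sH y sy.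
  by rewrite (component_homog n yd); case: ifP => // _; apply: mspan_mem.
Qed.

(** Each generator has finitely many components, all of them in the graded [N], and may be replaced
    by them. *)
Lemma homogeneous_generators N s : graded N -> {in s, forall y, N y} ->
  exists s', [/\ {in s', forall y, N y}, {in s', forall y, homogeneous cB y} &
    mspan r s `<=` mspan r s'].
Proof.
move=> gN; elim: s => [|x s IH] Ns; first by exists [::]; split.
have [y ys|s' [Ns' hs' ss']] := IH; first by apply: Ns; rewrite inE ys orbT.
have [M xM] := component_sum cB x.
exists ([seq cB n x | n <- iota 0 M] ++ s'); split.
- move=> y; rewrite mem_cat => /orP[/mapP[n _ ->]|/Ns'//].
  by apply/gN/Ns; rewrite mem_head.
- move=> y; rewrite mem_cat => /orP[/mapP[n _ ->]|/hs'//].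
  by exists n; rewrite component_component eqxx.
set t := _ ++ _ => z; apply; first exact: mspan_submod.
move=> y; rewrite inE => /predU1P[->|sy].
  rewrite xM; apply: (submod_sum (f := cB ^~ x) (mspan_submod r t)) => i iM.
  apply: mspan_mem; rewrite mem_cat; apply/orP; left.
  by apply/mapP; exists i; rewrite // mem_iota.
apply: (@mspan_sub _ _ _ s') => [u us|]; first by rewrite mem_cat us orbT.
by apply: ss'; apply: mspan_mem.
Qed.

(** * Hilbert's basis argument for the powers of one element *)

Section Filtration.
Variables (J : set B) (g : B) (e Q : nat) (t : A).
Hypotheses (J_sub : submod r J) (g_homog : cB e g = g) (Q_gt0 : (0 < Q)%N).
Hypotheses (gQ : r t = g ^+ Q) (gQ_comm : forall x, x * g ^+ Q = g ^+ Q * x).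
Hypothesis Jg : forall x, J x -> J (x * g).

Definition add_ideal : set B := fun x => exists2 b, True & J (x - b * g).

Hypothesis noeth : rel_noetherian add_ideal.

Variable N : set B.
Hypotheses (N_sub : submod r N) (N_graded : graded N) (JN : J `<=` N).

Let Jgn n x : J x -> J (x * g ^+ n).
Proof.
by move=> Jx; elim: n => [|n IH]; rewrite ?mulr1 // exprSr mulrA; apply: Jg.
Qed.

(** Right multiplication by powers of [g ^+ Q] is a scalar action of [A], so submodules are stable
    under it. *)
Let mulr_gQ x k : x * g ^+ (Q * k) = r (t ^+ k) * x.
Proof.
rewrite rmorphXn gQ exprM; elim: k => [|k IH].
  by rewrite !expr0 mulr1 mul1r.
by rewrite !exprSr mulrA IH -!mulrA gQ_comm.
Qed.

(* The coefficients of g^i in elements of N, modulo higher powers of g. *)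
Definition leading i : set B :=
  fun m => exists m', N (m * g ^+ i + m' * g ^+ i.+1).

Lemma leading_sub i : submod r (leading i).
Proof.
have [N0 ND NM] := N_sub; split=> [|x y [x' Nx] [y' Ny]|a x [x' Nx]].
- by exists 0; rewrite !mul0r addr0.
- by exists (x' + y'); rewrite !mulrDl addrACA; apply: ND.
- by exists (r a * x'); rewrite -!mulrA -mulrDr; apply: NM.
Qed.

(** Take the part of degree [n + i * e] of [x * g ^+ i + x' * g ^+ i.+1]: the second coefficient
    becomes the part of [x'] of degree [n - e], or 0 when [n < e]. *)
Lemma leading_graded i : graded (leading i).
Proof.
move=> n x [x' Nx]; exists (if (e <= n)%N then cB (n - e)%N x' else 0).
have := N_graded (n + i * e) Nx; rewrite componentD.
rewrite !(componentM_homogr _ _ (component_exp _ g_homog)) leq_addl addnK.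
rewrite mulSn leq_add2r subnDr.
by case: ifP; rewrite ?mul0r.
Qed.

Lemma leading_add_ideal i : add_ideal `<=` leading i.
Proof.
move=> x [b _ Jx]; exists (- b).
by rewrite exprS mulrA mulNr -mulrDl; apply/JN/Jgn.
Qed.

(** As [N] is only an [A]-submodule, multiplying by [g] may leave it; only [g ^+ Q] acts by a
    scalar, so the chain grows in steps of [Q]. *)
Lemma leading_shift i k : leading i `<=` leading (i + k * Q).
Proof.
move=> m [m' Nm]; exists m'; rewrite -addSn !exprD !mulrA -mulrDl mulnC.
by rewrite mulr_gQ; case: N_sub => _ _; apply.
Qed.

(** For each residue [u] modulo [Q] the union of the chain is a graded submodule containing
    [add_ideal]. It is finitely generated modulo [add_ideal], and finitely many generators occur at
    one common stage. Adding up the stages gives a bound valid for all residues. *)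
Lemma leading_stable : exists K, forall u k, (u < Q)%N ->
  leading (u + k * Q) `<=` leading (u + K * Q).
Proof.
suff stab u : exists K, forall k, leading (u + k * Q) `<=` leading (u + K * Q).
  suff /(_ Q) : forall q, exists K, forall u k, (u < q)%N ->
    leading (u + k * Q) `<=` leading (u + K * Q) by [].
  elim=> [|q [K KP]]; first by exists 0%N.
  have [L LP] := stab q; exists (K + L)%N => u k.
  rewrite ltnS leq_eqVlt => /predU1P[->|uq] x.
    move/LP => /(@leading_shift _ K).
    by rewrite -addnA -mulnDl [(L + K)%N]addnC.
  move/(KP _ _ uq) => /(@leading_shift _ L).
  by rewrite -addnA -mulnDl.
pose U := (fun m => exists k, leading (u + k * Q) m) : set B.
have up k l m : leading (u + k * Q) m -> leading (u + (k + l) * Q) m.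
  by rewrite mulnDl addnA; apply: leading_shift.
have U_sub : submod r U.
  split=> [|x y [k kx] [l ly]|a x [k kx]].
  - by exists 0%N; case: (leading_sub (u + 0 * Q)).
  - exists (k + l)%N; have [_ + _] := leading_sub (u + (k + l) * Q).
    by apply; [apply: up | rewrite [(k + l)%N]addnC; apply: up].
  - by exists k; case: (leading_sub (u + k * Q)) => _ _; apply.
have U_graded : graded U by move=> n x [k kx]; exists k; apply: leading_graded.
have [x xJ|s Us sU] := noeth U_sub U_graded.
  by exists 0%N; apply: leading_add_ideal.
have [K KP] : exists K, {in s, forall y, leading (u + K * Q) y}.
  elim: s Us {sU} => [|x s IH] Us; first by exists 0%N.
  have [y ys|K KP] := IH; first by apply: Us; rewrite inE ys orbT.
  have [L Lx] := Us x (mem_head _ _); exists (L + K)%N => y.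
  rewrite inE => /predU1P[->|/KP]; first exact: up.
  by rewrite [(L + K)%N]addnC; apply: up.
exists K => k x kx; have [|j jJ xj] := sU x; first by exists k.
rewrite -(subrK j x); have [_ + _] := leading_sub (u + K * Q); apply.
  by apply: xj => //; apply: leading_sub.
exact: leading_add_ideal.
Qed.

(** One division step: modulo [J] and a combination of [s], a term of order [i] with coefficient [m]
    is pushed to order [i.+1]. *)
Definition reduces s i : set B := fun m =>
  exists m' l, [/\ mspan r s l & J (m * g ^+ i - m' * g ^+ i.+1 - l)].

Lemma reduces_sub s i : submod r (reduces s i).
Proof.
have [J0 JD JM] := J_sub; have [s0 sD sM] := mspan_submod r s.
split=> [|x y [x' [k [sk Jx]]] [y' [l [sl Jy]]]|a x [x' [k [sk Jx]]]].
- by exists 0, 0; split=> //; rewrite !mul0r !subr0.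
- exists (x' + y'), (k + l); split; first exact: sD.
  by rewrite !mulrDl !opprD (addrACA (x * _)) [X in J X]addrACA; apply: JD.
- exists (r a * x'), (r a * k); split; first exact: sM.
  by rewrite -!mulrA -!mulrBr; apply: JM.
Qed.

Lemma reduces_mono s s' i : {subset s <= s'} -> reduces s i `<=` reduces s' i.
Proof.
by move=> ss m [m' [l [sl Jm]]]; exists m', l; split=> //; apply: mspan_sub sl.
Qed.

Lemma leading_reduces i : exists2 s, {in s, forall y, N y} &
  leading i `<=` reduces s i.
Proof.
have [x|s ls sP] := noeth (leading_sub i) (@leading_graded i).
  exact: leading_add_ideal.
have [J0 _ _] := J_sub.
suff [s' Ns' ss'] : exists2 s', {in s', forall y, N y} &
    {in s, forall y, reduces s' i y}.
  exists s' => // x /sP[j [b _ jb] xj]; rewrite -(subrK j x).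
  have [_ + _] := reduces_sub s' i; apply.
    by apply: xj => //; apply: reduces_sub.
  exists b, 0; split; first by case: (mspan_submod r s').
  by rewrite subr0 exprS mulrA -mulrBl; apply: Jgn.
elim: s ls {sP} => [|x s IH] ls; first by exists [::].
have [y ys|s' Ns' ss'] := IH; first by apply: ls; rewrite inE ys orbT.
have [x' Nx] := ls x (mem_head _ _).
exists (x * g ^+ i + x' * g ^+ i.+1 :: s').
  by move=> y; rewrite inE => /predU1P[->|/Ns'].
move=> y; rewrite inE => /predU1P[->|/ss']; last first.
  by apply: reduces_mono => z zs; rewrite inE zs orbT.
exists (- x'), (x * g ^+ i + x' * g ^+ i.+1); split.
  by apply: mspan_mem; rewrite mem_head.
by rewrite mulNr opprK subrr.
Qed.

(** Orders below [K.+1 * Q] need finitely many generators. At a higher order the coefficient already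
    occurs at order [i %% Q + K * Q], and the division found there is multiplied by a power of
    [g ^+ Q], that is, by a power of [t]. The exponent [i %/ Q - K] is recorded because for [g = p]
    it makes the successive corrections converge; it is 0 at the low orders, the subtraction being
    truncated. *)
Lemma filtration_generators : exists K s, {in s, forall y, N y} /\
  forall i b, N (b * g ^+ i) -> exists b' l, [/\ mspan r s l &
    J (b * g ^+ i - b' * g ^+ i.+1 - r (t ^+ (i %/ Q - K)) * l)].
Proof.
have [K KP] := leading_stable.
have [s Ns sP] : exists2 s, {in s, forall y, N y} &
    forall i, (i < K.+1 * Q)%N -> leading i `<=` reduces s i.
  elim: (K.+1 * Q)%N => [|n [s Ns sP]]; first by exists [::].
  have [s' Ns' s'P] := leading_reduces n; exists (s ++ s').
    by move=> y; rewrite mem_cat => /orP[/Ns|/Ns'].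
  move=> i; rewrite ltnS leq_eqVlt => /predU1P[->|/sP ss] x; last first.
    by move/ss; apply: reduces_mono => y ys; rewrite mem_cat ys.
  by move/s'P; apply: reduces_mono => y ys; rewrite mem_cat ys orbT.
exists K, s; split=> // i b Nb.
have lb : leading i b by exists 0; rewrite mul0r addr0.
have [iK|Ki] := ltnP i (K.+1 * Q).
  have [b' [l [sl Jb]]] := sP i iK b lb; exists b', l; split=> //.
  have -> : (i %/ Q - K)%N = 0%N by apply/eqP; rewrite subn_eq0 -ltnS ltn_divLR.
  by rewrite expr0 rmorph1 mul1r.
have Ki' : (K <= i %/ Q)%N by rewrite leq_divRL // (leq_trans _ Ki) // leq_mul.
have iQ : (i %% Q < Q)%N by rewrite ltn_mod.
move: lb; rewrite {1}(divn_eq i Q) addnC => /(KP _ _ iQ)/sP[|b' [l [sl Jb]]].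
  by rewrite mulSn ltn_add2r.
exists b', l; split=> //; set k := (i %/ Q - K)%N.
have iE : i = (i %% Q + K * Q + Q * k)%N.
  by rewrite -addnA [(Q * k)%N]mulnC -mulnDl subnKC // addnC -divn_eq.
rewrite -mulr_gQ.
move: (i %% Q + K * Q)%N iE Jb => j -> Jb.
by rewrite -addSn !exprD !mulrA -!mulrBl; apply: Jgn.
Qed.
End Filtration.

(** Dividing repeatedly moves an element of [N] into arbitrarily high powers of [g]. As [g] has
    positive degree, these powers do not meet a given degree, so the division is exact degree by
    degree. *)
Lemma rel_noetherian_step J g e Q t : submod r J -> graded J ->
  cB e g = g -> (0 < e)%N -> (0 < Q)%N -> r t = g ^+ Q ->
  (forall x, x * g ^+ Q = g ^+ Q * x) -> (forall x, J x -> J (x * g)) ->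
  rel_noetherian (add_ideal J g) -> rel_noetherian J.
Proof.
move=> J_sub J_gr ge e0 Q0 tQ gQ Jg Jn N N_sub N_gr JN.
have [K [s [Ns sP]]] :=
  filtration_generators J_sub ge Q0 tQ gQ Jg Jn N_sub N_gr JN.
have [s' [Ns' hs' ss']] := homogeneous_generators N_gr Ns.
have S_sub := mspan_submod r s'.
have S_gr := mspan_graded hs'.
have [[J0 JD JM] [S0 SD SM]] := (J_sub, S_sub).
pose L := (fun x => exists2 j, J j & mspan r s' (x - j)) : set B.
have L_sub : submod r L.
  split=> [|x y [j Jj xj] [k Jk yk]|a x [j Jj xj]].
  - by exists 0; rewrite ?subr0.
  - by exists (j + k); [apply: JD | rewrite opprD addrACA; apply: SD].
  - by exists (r a * j); [apply: JM | rewrite -mulrBr; apply: SM].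
have L_gr : graded L.
  move=> n x [j Jj xj]; exists (cB n j); first exact: J_gr.
  by rewrite -componentB; apply: S_gr.
have LN : L `<=` N.
  move=> x [j Jj xj]; rewrite -(subrK j x); have [_ ND _] := N_sub.
  by apply: ND; [apply: xj | apply: JN].
have approx i x : N x -> exists b, L (x - b * g ^+ i).
  move=> Nx; elim: i => [|i [b Lb]].
    by exists x; rewrite mulr1 subrr; case: L_sub.
  have [|b' [l [sl Jl]]] := sP i b.
    by rewrite -[_ * _](subKr x); apply: (submodB N_sub Nx (LN _ Lb)).
  exists b'; rewrite -(subrK (b * g ^+ i) x) -addrA.
  have [_ LD LM] := L_sub; apply: (LD) => //.
  rewrite -[X in L X](subrK (r (t ^+ (i %/ Q - K)) * l)); apply: (LD).
    by exists (b * g ^+ i - b' * g ^+ i.+1 - r (t ^+ (i %/ Q - K)) * l);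
      rewrite ?subrr.
  by apply: LM; exists 0; rewrite ?subr0 //; apply: ss'.
exists s' => // x Nx; have [M ->] := component_sum cB x.
apply: (submod_sum (f := cB ^~ x) L_sub) => n _.
(* Order [n.+1] suffices: since [e] is positive, [b * g ^+ n.+1] has no component of degree [n]. *)
have [b /(L_gr n)] := approx n.+1 (cB n x) (N_gr _ _ Nx).
rewrite componentB (componentM_homogr _ _ (component_exp _ ge)).
rewrite component_component eqxx ifN ?subr0 //.
by rewrite -ltnNge (leq_trans (ltnSn n)) // leq_pmulr.
Qed.
End GradedNoetherian.

Lemma submod_idfun (A B : pzRingType) (r : {rmorphism A -> B}) (N : set B) :
  submod idfun N -> submod r N.
Proof. by case=> N0 ND NM; split=> // a x; apply: NM. Qed.

(** * Finiteness of B and of A / pA as graded A-modules *)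

Section FiniteModule.
Variables (A B : pzRingType) (r : {rmorphism A -> B}).
Variables (cA : grading A) (cB : grading B).
Hypothesis rc : forall n a, r (cA n a) = cB n (r a).
Hypothesis B_noeth : left_noetherian B.
Hypothesis B_comm : forall x y, homogeneous cB x -> homogeneous cB y ->
  x * y = y * x \/ x * y = - (y * x).
Hypothesis rA0 : forall x, exists a, r a = cB 0%N x.

(** Passing a component of [y] across [x] twice produces the same sign twice. *)
Lemma sqr_central x y : homogeneous cB x -> GRing.comm y (x ^+ 2).
Proof.
move=> hx; have [M ->] := component_sum cB y; rewrite /GRing.comm.
rewrite big_distrl big_distrr /=; apply: eq_bigr => n _.
have [|xy|xy] := B_comm (x := cB n y) _ hx.
- by exists n; rewrite component_component eqxx.
- by rewrite expr2 mulrA xy -mulrA xy mulrA.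
- by rewrite expr2 mulrA xy mulNr -mulrA xy mulrN opprK mulrA.
Qed.

Definition positive : set B := fun x => cB 0%N x = 0.

Lemma component0M x y : cB 0%N (x * y) = cB 0%N x * cB 0%N y.
Proof. by rewrite componentM big_ord1. Qed.

Lemma positive_ideal : left_ideal positive.
Proof.
split=> [|x y|b x]; rewrite /positive ?component0 ?componentD ?component0M //.
  by move=> -> ->; rewrite addr0.
by move=> ->; rewrite mulr0.
Qed.

Lemma rel_noetherian_mono J J' : J `<=` J' ->
  rel_noetherian r cB J -> rel_noetherian r cB J'.
Proof.
move=> JJ Jn N N_sub N_gr JN; have [|s Ns sP] := Jn N N_sub N_gr.
  by move=> x /JJ/JN.
by exists s => // x /sP[j /JJ]; exists j.
Qed.

(** Degree 0 of [B] comes from [A], so an [A]-submodule containing [positive] is a left ideal of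
    [B]. Modulo [positive] its generators over [B] also generate it over [A]. *)
Lemma rel_noetherian_positive : rel_noetherian r cB positive.
Proof.
move=> N N_sub N_gr PN.
have [P0 PD PM] := positive_ideal.
have [N0 ND NM] := N_sub.
have N_ideal : left_ideal N.
  split=> // b x Nx; rewrite -(subrK (cB 0%N b) b) mulrDl; apply: ND.
    apply: PN; rewrite /positive component0M componentB component_component.
    by rewrite eqxx subrr mul0r.
  by have [a <-] := rA0 b; apply: NM.
have [s Ns] := B_noeth N_ideal.
exists s => [y sy|]; first by rewrite Ns; apply: left_span_mem.
have [s0 sD sM] := mspan_submod r s.
rewrite {1}Ns; apply: left_span_min => [|x sx]; last first.
  by exists 0; rewrite ?subr0 //; apply: mspan_mem.
split=> [|x y [j Pj xj] [k Pk yk]|b x [j Pj xj]].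
- by exists 0; rewrite ?subr0.
- by exists (j + k); [apply: PD | rewrite opprD addrACA; apply: sD].
(* What remains of [b * x] is [cB 0 b * (x - j)], a scalar of [A] acting on an element of the
   span. *)
exists (b * j + (b - cB 0%N b) * (x - j)).
  apply: PD; first exact: PM.
  rewrite /positive component0M componentB component_component.
  by rewrite eqxx subrr mul0r.
have [a ra] := rA0 b; rewrite opprD addrA -mulrBr -mulrBl subKr -ra.
exact: sM.
Qed.

Variable q : nat.
Hypothesis q_gt0 : (0 < q)%N.
Hypothesis lift_power : forall x, homogeneous cB x -> exists t, r t = x ^+ (2 *
  q).

(** The positive ideal has finitely many homogeneous generators. Modulo all of them
    [rel_noetherian_positive] applies; [rel_noetherian_step] then removes them one by one, with
    period [2 * q], because the power [2 * q] of a generator lifts to [A] and is central. *)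
Lemma rel_noetherian0 : rel_noetherian r cB [set 0].
Proof.
have [s Ps] := B_noeth positive_ideal.
have P_gr : graded cB positive.
  move=> n x; rewrite /positive component_component.
  by case: eqP => // <- ->.
have [|s' [Ps' hs' ss']] := homogeneous_generators idfun (s := s) P_gr.
  by move=> y sy; rewrite Ps; apply: left_span_mem.
have : rel_noetherian r cB (mspan idfun s').
  apply: rel_noetherian_mono rel_noetherian_positive => x Px; apply: ss'.
  move: Px; rewrite Ps; apply: left_span_min => [|y sy]; last exact: mspan_mem.
  exact: mspan_submod.
have q2 : (0 < 2 * q)%N by rewrite muln_gt0.
elim: s' Ps' hs' {ss'} => [|u s' IH] Ps' hs' noeth.
  apply: rel_noetherian_mono noeth => x /(_ [set 0]); apply=> //.
  split=> //= [y z -> ->|a y ->]; rewrite ?addr0 ?mulr0 //.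
have su y : y \in s' -> y \in u :: s' by rewrite inE => ->; rewrite orbT.
apply: IH => [y /su/Ps'//|y /su/hs'//|].
have [Pu hu] : positive u /\ homogeneous cB u.
  by split; [apply: Ps' | apply: hs']; rewrite mem_head.
(* If [u] is homogeneous of degree 0 it vanishes, being positive, and then degree 1 serves as
   well. *)
have [e e0 ue] : exists2 e, (0 < e)%N & cB e u = u.
  have [[|d] ud] := hu; last by exists d.+1.
  by exists 1%N; rewrite // -ud Pu component0.
have [t tu] := lift_power hu.
have [s0 sD sM] := mspan_submod idfun s'.
apply: (rel_noetherian_step (g := u) (Q := (2 * q)%N) (t := t) rc _ _ ue e0) =>
  //.
- exact/submod_idfun/mspan_submod.
- by apply: (mspan_graded (cA := cB)) => // y /su/hs'.
- by move=> x; rewrite exprM; apply/commrX/sqr_central.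
(* The left ideal spanned by [s'] is stable under right multiplication by [u], since [u] moves to
   the left of each generator up to sign. *)
- move=> x /(_ (fun x => mspan idfun s' (x * u))); apply=> [|y ys]; first split.
  + by rewrite mul0r.
  + by move=> y z sy sz; rewrite mulrDl; apply: sD.
  + by move=> a y sy; rewrite -mulrA; apply: sM.
  + have [|->|->] := B_comm (x := y) (y := u) _ hu.
    * exact/hs'/su.
    * by apply: (sM); apply: mspan_mem.
    * by apply: (submodN (mspan_submod idfun s')); apply: (sM);
      apply: mspan_mem.
- by apply: rel_noetherian_mono noeth => x /mspan_cons[a sa]; exists a.
Qed.

Variable p : nat.
Hypothesis ker_r : forall a, r a = 0 -> exists a', a = a' *+ p.

(** A submodule containing [pA] contains the kernel of [r], so generators of its image in [B],
    lifted into it, generate it modulo [pA]. *)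
Lemma rel_noetherian_mod : rel_noetherian idfun cA (add_ideal [set 0] p%:R).
Proof.
move=> N N_sub N_gr pN; have [N0 ND NM] := N_sub.
have [|||s Ns sP] := rel_noetherian0 (N := r @` N).
- split=> [|_ _ [x Nx <-] [y Ny <-]|a _ [x Nx <-]].
  + by exists 0; rewrite ?rmorph0.
  + by exists (x + y); rewrite ?rmorphD //; apply: ND.
  + by exists (a * x); rewrite ?rmorphM //; apply: NM.
- by move=> n _ [x Nx <-]; exists (cA n x); [apply: N_gr | rewrite rc].
- by move=> _ ->; exists 0; rewrite ?rmorph0.
have [s' Ns' ss'] : exists2 s', {in s', forall y, N y} & {subset s <= map r s'}.
  elim: s Ns {sP} => [|x s IH] Ns; first by exists [::].
  have [y ys|s' Ns' ss'] := IH; first by apply: Ns; rewrite inE ys orbT.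
  have [x' Nx' x'E] := Ns x (mem_head _ _); exists (x' :: s').
    by move=> y; rewrite inE => /predU1P[->|/Ns'].
  move=> y; rewrite inE => /predU1P[->|/ss'] /=; first by rewrite x'E mem_head.
  by rewrite inE => ->; rewrite orbT.
exists s' => // x Nx; have [|_ -> ] := sP (r x); first by exists x.
rewrite subr0 => xs.
have [s0 sD sM] := mspan_submod idfun s'.
have [l sl rl] : exists2 l, mspan idfun s' l & r l = r x.
  apply: (xs (fun y => exists2 l, mspan idfun s' l & r l = y)).
    split=> [|_ _ [y sy <-] [z sz <-]|a _ [y sy <-]].
    + by exists 0; rewrite ?rmorph0.
    + by exists (y + z); rewrite ?rmorphD //; apply: sD.
    + by exists (a * y); rewrite ?rmorphM //; apply: sM.
  by move=> y /ss'/mapP[z sz ->]; exists z => //; apply: mspan_mem.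
have [|y xl] := ker_r (a := x - l); first by rewrite rmorphB rl subrr.
exists (x - l); last by rewrite opprB addrCA subrr addr0.
by exists y; rewrite // mulr_natr xl; apply: subrr.
Qed.
End FiniteModule.

(** * From A / pA to A by p-adic approximation *)

Section Lifting.
Variables (A : pzRingType) (c : grading A) (p : nat).
Implicit Types (N I : set A) (s : seq A).

Hypothesis mod_p_noetherian : rel_noetherian idfun c (add_ideal [set 0] p%:R).
Hypothesis p_complete : forall k (a : nat -> A), (forall i, c k (a i) = a i) ->
  exists b, forall n, exists y, b = \sum_(i < n) a i *+ p ^ i + y *+ p ^ n.
Hypothesis p_separated : forall x : A,
  (forall n, exists y : A, x = y *+ p ^ n) -> x = 0.

(** A finitely generated span is closed under p-adic sums within one degree: the series is summed
    coefficient by coefficient, one generator at a time. *)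
Lemma mspan_complete s k (l : nat -> A) : {in s, forall y, homogeneous c y} ->
  (forall i, mspan idfun s (l i)) ->
  exists2 b, mspan idfun s b &
    forall n, exists y, b = \sum_(i < n) c k (l i) *+ p ^ i + y *+ p ^ n.
Proof.
elim: s l => [|u s IH] l hs sl.
  exists 0; first by case: (mspan_submod idfun ([::] : seq A)).
  move=> n; exists 0; rewrite mul0rn addr0 big1 // => i _.
  rewrite (_ : l i = 0) ?component0 ?mul0rn //;
    apply: (sl i (fun x => x = 0)) => //.
  by split=> //= [y z -> ->|a y ->]; rewrite ?addr0 ?mulr0.
have [a al] := choice (fun i => mspan_cons (sl i)).
have [y ys|b sb bP] := IH (fun i => l i - a i * u) _ al.
  by apply: hs; rewrite inE ys orbT.
have [d ud] := hs u (mem_head _ _).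
(* In degree [k] a generator of degree [d] only meets the part of its coefficient of degree [k - d];
   the test excludes the truncated subtraction when [k < d]. *)
pose a' i := if (d <= k)%N then c (k - d)%N (a i) else 0.
have [|b' b'P] := p_complete (k := (k - d)%N) (a := a').
  by move=> i; rewrite /a'; case: ifP;
    rewrite ?component0 ?component_component ?eqxx.
have [s0 sD sM] := mspan_submod idfun (u :: s).
exists (b + b' * u).
  apply: sD; first by apply: mspan_sub sb => y ys; rewrite inE ys orbT.
  by apply: sM; apply: mspan_mem; rewrite mem_head.
move=> n; have [[y ->] [y' ->]] := (bP n, b'P n); exists (y + y' * u).
rewrite mulrDl mulrnAl big_distrl /= addrACA -big_split /= -mulrnDl.
congr (_ + _); apply: eq_bigr => i _.
rewrite componentB (componentM_homogr _ _ ud) mulrnAl -mulrnDl /a'.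
by case: ifP; rewrite ?mul0r subrK.
Qed.

(** The filtration argument for [g = t = p] and [Q = 1]. As p has degree 0, division does not stop
    in a given degree; instead the corrections carry growing powers of p and are summed by
    completeness, and separatedness kills the remainder. *)
Lemma graded_ideal_generated N : left_ideal N -> graded c N -> exists s,
  [/\ {in s, forall y, N y}, {in s, forall y, homogeneous c y} &
      N `<=` mspan idfun s].
Proof.
move=> N_sub N_gr; have [N0 ND NM] := N_sub.
have J_sub : submod (idfun : {rmorphism A -> A}) [set 0].
  by split=> //= [y z -> ->|a y ->]; rewrite ?addr0 ?mulr0.
have p_homog : c 0%N p%:R = p%:R by rewrite componentMn component_one.
have pC (x : A) : x * p%:R ^+ 1 = p%:R ^+ 1 * x by exact: commr_nat.
have J0 (x : A) : [set 0] x -> [set 0] (x * p%:R) by move=> ->; exact: mul0r.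
have JN : [set 0] `<=` N by move=> _ ->.
have [K [s [Ns sP]]] := filtration_generators (r := idfun) (Q := 1%N)
  (t := p%:R) J_sub p_homog isT erefl pC J0 mod_p_noetherian N_sub N_gr JN.
have [s' [Ns' hs' ss']] := homogeneous_generators idfun N_gr Ns.
exists s'; split=> // x Nx.
have S_sub := mspan_submod idfun s'; have [S0 SD SM] := S_sub.
have SN : mspan idfun s' `<=` N by move=> y; apply.
(* The existentials are moved out of the implication, with default value 0, so that choice yields
   total functions. *)
have {}sP (b : A) i : exists b' l, N (b *+ p ^ i) ->
    mspan idfun s' l /\ b *+ p ^ i = b' *+ p ^ i.+1 + l *+ p ^ (i - K).
  have [Nb|] := pselect (N (b *+ p ^ i)); last by exists 0, 0.
  have [|b' [l [sl]]] := sP i b; first by rewrite -natrX mulr_natr.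
  rewrite divn1 -!natrX !mulr_natr mulr_natl => /subr0_eq bl.
  exists b', l => _; split; first exact: ss'.
  by rewrite -bl addrC subrK.
have [M ->] := component_sum c x.
apply: (submod_sum (f := c ^~ x) S_sub) => k _.
move: (c k x) (N_gr k x Nx) (component_component c k k x); rewrite eqxx.
move=> {x Nx M} x Nx xk.
have /choice[f /choice[g fgP]] :
    forall bi : A * nat, exists b', exists l, N (bi.1 *+ p ^ bi.2) ->
      mspan idfun s' l /\
      bi.1 *+ p ^ bi.2 = b' *+ p ^ bi.2.+1 + l *+ p ^ (bi.2 - K).
  by case.
(* [b i *+ p ^ i] is the remainder of [x] after [i] divisions and [l i] is the next correction. *)
pose b := fix b i := if i is j.+1 then f (b j, j) else x.
pose l i := g (b i, i).
have Nb i : N (b i *+ p ^ i).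
  elim: i => [|i IH] //=; have [sl bE] := fgP (b i, i) IH.
  have : N (b i *+ p ^ i - l i *+ p ^ (i - K)).
    apply: (submodB (r := idfun) N_sub) => //; rewrite -mulr_natl; apply: NM.
    exact: SN.
  by rewrite bE /= addrK.
have sl i : mspan idfun s' (l i) by have [] := fgP (b i, i) (Nb i).
have bE i : b i *+ p ^ i = b i.+1 *+ p ^ i.+1 + l i *+ p ^ (i - K).
  by have [_ ->] := fgP (b i, i) (Nb i).
have xE n : x = \sum_(i < n) l i *+ p ^ (i - K) + b n *+ p ^ n.
  elim: n => [|n ->]; first by rewrite big_ord0 add0r.
  by rewrite big_ord_recr /= bE addrAC addrA.
(* The first [K] corrections have exponent [i - K = 0] and form the finite sum [z0]; the others form
   a genuine p-adic series, with sum [z]. *)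
have [z sz zP] := mspan_complete (l := fun i => l (K + i)%N) k hs'
  (fun i => sl (K + i)%N).
pose z0 := \sum_(i < K) c k (l i *+ p ^ (i - K)).
suff /subr0_eq -> : x - (z0 + z) = 0.
  apply: SD => //.
  apply: (submod_sum (f := fun i => c k (l i *+ p ^ (i - K))) S_sub) => i _.
  apply: (mspan_graded (cA := c)) => //.
  by rewrite -mulr_natl; apply: SM.
apply: p_separated => n; have [y ->] := zP n.
exists (c k (b (K + n)%N) *+ p ^ K - y).
rewrite mulrnBl -mulrnA -expnD -componentMn [z0 + _]addrA opprD addrA.
congr (_ - _); rewrite -[in LHS]xk [in LHS](xE (K + n)%N) componentD.
set T := c k (\sum_(i < _) _).
suff -> : z0 + \sum_(i < n) c k (l (K + i)%N) *+ p ^ i = T by rewrite addrC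
  addKr.
rewrite /T component_bigsum big_split_ord /=; congr (_ + _).
by apply: eq_bigr => i _; rewrite addKn componentMn.
Qed.

(** The ideal of top-degree forms of [I]. The condition is imposed on every component of [x], so
    that it also makes sense for inhomogeneous elements; the zero form is allowed. *)
Definition leading_forms I : set A := fun x => forall n, exists y,
  [/\ I y, forall m, (n < m)%N -> c m y = 0 & c n y = c n x].

Lemma leading_forms_ideal I : left_ideal I -> left_ideal (leading_forms I).
Proof.
case=> I0 ID IM; split=> [|x y xI yI|a x xI] n.
- by exists 0; split=> // m _; rewrite component0.
- have [x' [Ix' x'n x'E]] := xI n; have [y' [Iy' y'n y'E]] := yI n.
  exists (x' + y'); split; first exact: ID.
    by move=> m nm; rewrite componentD x'n // y'n // addr0.
  by rewrite !componentD x'E y'E.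
- have [f fP] := choice xI.
  exists (\sum_(k < n.+1) c k a * f (n - k)%N); split.
  + apply: left_ideal_sum => // k; apply: IM.
    by have [] := fP (n - k)%N.
  + move=> m nm; rewrite component_bigsum big1 // => k _.
    have ak : c k (c k a) = c k a by rewrite component_component eqxx.
    have kn : (k <= n)%N by rewrite -ltnS.
    rewrite (componentM_homogl _ _ ak) (leq_trans kn (ltnW nm)).
    have [_ fn _] := fP (n - k)%N.
    by rewrite fn ?mulr0 // ltn_sub2r // (leq_ltn_trans kn).
  + rewrite component_bigsum componentM; apply: eq_bigr => k _.
    have ak : c k (c k a) = c k a by rewrite component_component eqxx.
    have kn : (k <= n)%N by rewrite -ltnS.
    rewrite (componentM_homogl _ _ ak) kn.
    by have [_ _ ->] := fP (n - k)%N.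
Qed.

(** Homogeneous generators of the ideal of leading forms are lifted to [I]. Subtracting from an
    element of [I] a combination with the same top form lowers its degree, so the lifts generate
    [I]. *)
Lemma left_noetherian_graded : left_noetherian A.
Proof.
move=> I II.
have [|s [Is hs sI]] := graded_ideal_generated (leading_forms_ideal II).
  move=> n x xI m; rewrite component_component; have [y [Iy yn yE]] := xI m.
  case: eqP => [mn|_]; last by exists 0; split=> [|k _|];
    rewrite ?component0 //; case: II.
  by exists y; split=> //; rewrite yE mn.
have [s' Is' ss'] : exists2 s', {in s', forall y, I y} &
    {in s, forall y, leading_forms (left_span s') y}.
  elim: s Is hs {sI} => [|x s IH] Is hs; first by exists [::].
  have [y ys|y ys|s' Is' ss'] := IH.
  - by apply: Is; rewrite inE ys orbT.
  - by apply: hs; rewrite inE ys orbT.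
  have [d xd] := hs x (mem_head _ _);
    have [x' [Ix' x'd x'E]] := Is x (mem_head _ _) d.
  have sub : left_span s' `<=` left_span (x' :: s').
    apply: left_span_min; first exact: left_span_ideal.
    by move=> y ys; apply: left_span_mem; rewrite inE ys orbT.
  exists (x' :: s') => [y|y]; rewrite inE => /predU1P[->//|]; first exact: Is'.
    move=> n; have [nd|nd] := eqVneq n d.
      by exists x'; rewrite nd; split=> //; apply: left_span_mem;
        rewrite mem_head.
    exists 0; split; first by case: (left_span_ideal (x' :: s')).
      by move=> m _; rewrite component0.
    by rewrite component0 (component_homog _ xd) (negPf nd).
  by move=> /ss' yI n; have [z [/sub sz zn zE]] := yI n; exists z.
exists s'; apply/seteqP; split; last exact: left_span_min.
suff deg n x : I x -> (forall m, (n <= m)%N -> c m x = 0) -> left_span s' x.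
  move=> x Ix; have [M xM] := component_sum c x; apply: (deg M) => // m Mm.
  rewrite xM component_bigsum big1 // => i _;
    rewrite component_component ifN //.
  by rewrite neq_ltn (leq_trans (ltn_ord i) Mm) orbT.
have [S0 SD SM] := left_span_ideal s'.
elim: n x => [|n IH] x Ix xn.
  by have [M ->] := component_sum c x; rewrite big1 // => i _; apply: xn.
have xI : leading_forms I (c n x).
  move=> m; rewrite component_component; case: eqP => [->|_].
    by exists x; split=> // k; apply: xn.
  by exists 0; split=> [|k _|]; rewrite ?component0 //; case: II.
have /(_ n)[z [sz zn zE]] : leading_forms (left_span s') (c n x).
  by apply: (sI _ xI) => //; apply/leading_forms_ideal/left_span_ideal.
have sIz : I z by move: sz; apply: left_span_min.
rewrite -(subrK z x); apply: SD => //; apply: IH.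
  by case: II => _ ID IM; apply: ID => //; rewrite -mulN1r; apply: IM.
move=> m; rewrite leq_eqVlt => /predU1P[<-|nm]; rewrite componentB.
  by rewrite zE component_component eqxx subrr.
by rewrite xn // zn // subr0.
Qed.
End Lifting.

(** * Transfer of the noetherian property *)

Section RingTransfer.

(** An anti-automorphism turns right ideals into left ideals, and their generators back into
    generators. *)
Lemma left_noetherian_anti (A : pzRingType) (tau : A -> A) :
  involutive tau -> {morph tau : x y / x + y} ->
  (forall x y, tau (x * y) = tau y * tau x) ->
  left_noetherian A -> left_noetherian A^c.
Proof.
move=> tauK tauD tauM A_noeth I [I0 ID IM].
have tau0 : tau 0 = 0 by apply: (addrI (tau 0)); rewrite -tauD !addr0.
have [|s Is] := A_noeth (I \o tau).
  split=> [|x y|a x] /=; first by rewrite tau0.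
    by rewrite tauD; apply: ID.
  by rewrite tauM; apply: IM.
have [J0 JD JM] := @left_span_ideal A^c (map tau s).
exists (map tau s); apply/seteqP; split=> x; last first.
  apply: left_span_min => // _ /mapP[y ys ->].
  have : (I \o tau) y by rewrite Is; apply: left_span_mem.
  by [].
have -> : I x = (I \o tau) (tau x) by rewrite /= tauK.
rewrite -{2}[x]tauK Is; move: (tau x) => y.
apply: (left_span_min (I := fun y => @left_span A^c (map tau s) (tau y))).
  split=> [|u v su sv|a u su]; rewrite ?tau0 // ?tauD ?tauM; first exact: JD.
  exact: (JM (tau a)).
by move=> u us; apply: left_span_mem; apply: map_f.
Qed.

(** The p-torsion is a left ideal, and an exponent that kills its finitely many generators kills all
    of it. *)
Lemma bounded_torsion_noetherian (A : pzRingType) p :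
  left_noetherian A -> bounded_torsion p A.
Proof.
move=> A_noeth; pose T : set A := fun x => exists k, x *+ p ^ k = 0.
have T_ideal : left_ideal T.
  split=> [|x y [k xk] [l yl]|a x [k xk]].
  - by exists 0%N; rewrite mul0rn.
  - exists (k + l)%N; rewrite mulrnDl expnD mulrnA xk mul0rn add0r.
    by rewrite mulnC mulrnA yl mul0rn.
  - by exists k; rewrite -mulrnAr xk mulr0.
have [s Ts] := A_noeth _ T_ideal.
have [d sd] : exists d, {in s, forall y, y *+ p ^ d = 0}.
  have : {in s, forall y, T y} by move=> y ys; rewrite Ts; apply: left_span_mem.
  elim: (s) => [|x s' IH] Tx; first by exists 0%N.
  have [y ys|d sd] := IH; first by apply: Tx; rewrite inE ys orbT.
  have [k xk] := Tx x (mem_head _ _); exists (k + d)%N => y.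
  rewrite inE => /predU1P[->|/sd yd]; first by rewrite expnD mulrnA xk mul0rn.
  by rewrite expnD mulnC mulrnA yd mul0rn.
exists d => x Tx; have : left_span s x by rewrite -Ts.
apply: (left_span_min (I := fun x : A => x *+ p ^ d = 0)) => //.
split=> [|y z yd zd|a y yd]; first by rewrite mul0rn.
  by rewrite mulrnDl yd zd addr0.
by rewrite -mulrnAr yd mulr0.
Qed.

(* beta is the graph of the connecting map B -> A of a short exact sequence   *)
(* of coefficients, linear up to the automorphism sigma of A.                 *)
Lemma left_noetherian_bockstein (A B : pzRingType) (r : {rmorphism A -> B})
    (sigma : A -> A) (beta : B -> A -> Prop) :
  (forall a, exists x, sigma x = a) ->
  (forall b, exists a, beta b a) ->
  (forall b b' a a', beta b a -> beta b' a' -> beta (b - b') (a - a')) ->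
  (forall x b a, beta b a -> beta (r x * b) (sigma x * a)) ->
  (forall b, beta b 0 -> exists x, r x = b) ->
  left_noetherian A -> left_noetherian B.
Proof.
move=> sigma_surj beta_total betaB betaM beta_ker A_noeth I II.
have [I0 ID IM] := II.
have beta0 : beta 0 0.
  by have [a ba] := beta_total 0; have := betaB _ _ _ _ ba ba; rewrite !subrr.
have betaD b b' a a' : beta b a -> beta b' a' -> beta (b + b') (a + a').
  move=> ba /(betaB _ _ _ _ beta0); rewrite !sub0r => ba'.
  by have := betaB _ _ _ _ ba ba'; rewrite !opprK.
(* The image of a left ideal under the connecting relation is a left ideal: by surjectivity every
   scalar is some [sigma z], and [r z] acts on the source. *)
have betaM' J : left_ideal J -> left_ideal (fun a => exists2 b, J b & beta b a).
  case=> J0 JD JM; split=> [|x y [b Jb bx] [b' Jb' bx']|a x [b Jb bx]].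
  - by exists 0.
  - by exists (b + b'); [apply: JD | apply: betaD].
  - have [z <-] := sigma_surj a.
    by exists (r z * b); [apply: JM | apply: betaM].
have IN x : I x -> I (- x) by rewrite -mulN1r; apply: IM.
have [s sP] := A_noeth _ (betaM' I II).
have [|t tP] := A_noeth (I \o r).
  split=> [|x y|a x] /=; rewrite ?rmorph0 ?rmorphD ?rmorphM //; first exact: ID.
  exact: IM.
have [u Iu us] : exists2 u : seq B, {in u, forall y, I y} &
    {in s, forall a, exists2 b, b \in u & beta b a}.
  have : {in s, forall a, exists2 b, I b & beta b a}.
    by move=> a sa; have := left_span_mem sa; rewrite -sP.
  elim: (s) => [|a s' IH] sI; first by exists [::].
  have [a' as'|u Iu us] := IH; first by apply: sI; rewrite inE as' orbT.
  have [b Ib ba] := sI a (mem_head _ _); exists (b :: u).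
    by move=> y; rewrite inE => /predU1P[->|/Iu].
  move=> a'; rewrite inE => /predU1P[->|/us[b' ub' b'a']].
    by exists b; rewrite ?mem_head.
  by exists b'; rewrite ?inE ?ub' ?orbT.
have [J0 JD JM] := left_span_ideal (u ++ map r t).
have JI : left_span (u ++ map r t) `<=` I.
  apply: left_span_min => // y; rewrite mem_cat => /orP[/Iu//|/mapP[a ta ->]].
  by have := left_span_mem ta; rewrite -tP.
exists (u ++ map r t); apply/seteqP; split=> // b Ib.
have [a ba] := beta_total b.
have : left_span s a by rewrite -sP; exists b.
case/(left_span_min (betaM' _ (left_span_ideal (u ++ map r t)))) => [a' /us[b'
  ub' b'a']|c Jc ca].
  by exists b' => //; apply: left_span_mem; rewrite mem_cat ub'.
(* The combination [c] of the chosen generators has the same connecting image as [b], so the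
   difference comes from the preimage of [I] in [A]. *)
have [x xbc] : exists x, r x = b - c.
  by apply: beta_ker; rewrite -(subrr a); apply: betaB.
rewrite -(subrK c b); apply: (JD) => //; rewrite -xbc.
have : (I \o r) x by rewrite /= xbc; apply: ID => //; apply/IN/JI.
rewrite tP; apply: (left_span_min (I := left_span (u ++ map r t) \o r)).
  split=> [|y z|d y] /=; rewrite ?rmorph0 ?rmorphD ?rmorphM //; first exact: JD.
  exact: JM.
by move=> y ty; apply: left_span_mem; rewrite mem_cat map_f ?orbT.
Qed.
End RingTransfer.

(** * p-adic integers *)

Lemma mulrn_int (x : int) k : x *+ k = x * k%:Z.
Proof. by rewrite -mulr_natr natz. Qed.

Section Padic.
Variable p : nat.
Hypothesis p_prime : prime p.
Implicit Types x y : padic p.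

Lemma padicMn x k n : (x *+ k) n = ((x n *+ k) %% (p ^ n)%N)%Z.
Proof.
elim: k => [|k IH]; first by rewrite !mulr0n.
by rewrite !mulrS /= IH modzDmr.
Qed.

Lemma padic_torsion_free k x : x *+ p ^ k = 0 -> x = 0.
Proof.
have p0 : (p%:Z != 0) by rewrite eqz_nat -lt0n prime_gt0.
elim: k x => [|k IH] x; first by rewrite mulr1n.
rewrite expnS mulrnA => /IH xp0; apply: padic_eq => n.
have := congr1 (fun y : padic p => y n.+1) xp0.
rewrite padicMn /= mod0z mulrn_int expnS PoszM [_ * p%:Z]mulrC => xn.
rewrite padic_compat mod0z; apply/eqP.
have : (p%:Z * (p ^ n)%N %| p%:Z * x n.+1)%Z by apply/dvdz_mod0P.
by rewrite dvdz_mul2l // => /dvdz_mod0P ->.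
Qed.

Lemma padic_separated x : (forall n, exists y, x = y *+ p ^ n) -> x = 0.
Proof.
move=> xp; apply: padic_eq => n; have [y ->] := xp n.
by rewrite padicMn /= mod0z mulrn_int modzMl.
Qed.

(** All tails of the series of the [a i *+ p ^ i] at once, [y i] being the sum of the
    [a (i + j) *+ p ^ j]. The recursion replaces limits and passes to cochains pointwise; modulo
    [p ^ n] the first [n] terms suffice. *)
Lemma padic_series (a : nat -> padic p) :
  exists y : nat -> padic p, forall i, y i = a i + y i.+1 *+ p.
Proof.
pose f i n := \sum_(j < n) a (i + j)%N n *+ p ^ j.
have fP i n : (f i n = f i n.+1 %[mod (p ^ n)%N])%Z.
  rewrite /f big_ord_recr /= addrC [X in (X + _)%R]mulrn_int modzMDl.
  elim/big_ind2: _ => // [u u' v v' uE vE|j _].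
    by rewrite -modzDm uE vE modzDm.
  by rewrite !mulrn_int -modzMml padicP modzMml.
exists (fun i => padic_of (fP i)) => i; apply: padic_eq => n /=.
rewrite padicMn modzDmr mulrn_int -modzDmr modzMml modzDmr.
suff -> : a i n + f i.+1 n * p = a (i + n)%N n * (p ^ n)%N + f i n.
  by rewrite modzMDl.
transitivity (\sum_(j < n.+1) a (i + j)%N n *+ p ^ j).
  rewrite big_ord_recl addn0 big_distrl /=; congr (_ + _).
  apply: eq_bigr => j _; rewrite addnS addSn expnSr mulrnA.
  by rewrite [RHS]mulrn_int.
by rewrite big_ord_recr /= addrC mulrn_int.
Qed.

Definition padic_red x : 'F_p := (x 1%N)%:~R.

Lemma Fp_modz (m : int) : (m %% p)%Z%:~R = m%:~R :> 'F_p.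
Proof.
rewrite [in RHS](divz_eq m p) [RHS]intrD intrM.
by rewrite (_ : p%:~R = 0) ?mulr0 ?add0r //; apply: pcharf0 (pchar_Fp p_prime).
Qed.

Fact padic_red_zmod_morphism : zmod_morphism padic_red.
Proof.
by move=> x y; rewrite /padic_red /= expn1 modzDmr Fp_modz intrD mulrNz.
Qed.

Fact padic_red_monoid_morphism : monoid_morphism padic_red.
Proof.
split=> [|x y]; first by rewrite /padic_red /= expn1 Fp_modz.
by rewrite /padic_red /= expn1 Fp_modz intrM.
Qed.

Definition padic_lift (u : 'F_p) : padic p := padic_cst p (val u)%:Z.

Lemma padic_liftK : cancel padic_lift padic_red.
Proof.
move=> u; rewrite /padic_red /= expn1 Fp_modz -[RHS]natr_Zp.
by rewrite -pmulrn.
Qed.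

(** Every [x n.+1] is divisible by p. Division costs one power of p, so the residue of the quotient
    modulo [p ^ n] is read off from [x n.+1]. *)
Lemma padic_red_eq0 x : padic_red x = 0 -> exists y, x = y *+ p.
Proof.
move=> x0; have p0 : (p%:Z != 0) by rewrite eqz_nat -lt0n prime_gt0.
have dvd n : (p %| x n.+1)%Z.
  elim: n => [|n IH].
    rewrite dvdzE (dvdn_pcharf (pchar_Fp p_prime)) pmulrn.
    by rewrite gez0_abs ?[_%:~R]x0 // -padic_mod expn1 modz_ge0.
  have /eqP := padicP x n.+1; rewrite eqz_mod_dvd => xn.
  rewrite -(subKr (x n.+1) (x n.+2)) rpredB //; apply: dvdz_trans xn.
  by rewrite expnS PoszM dvdz_mulr.
have qP n : ((x n.+1 %/ p)%Z = (x n.+2 %/ p)%Z %[mod (p ^ n)%N])%Z.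
  apply/eqP; rewrite eqz_mod_dvd -(dvdz_mul2l p0) mulrBr.
  rewrite ![p%:Z * (_ %/ _)%Z]mulrC !divzK // -PoszM -expnS -eqz_mod_dvd.
  exact/eqP/padicP.
exists (padic_of qP); apply: padic_eq => n; rewrite padicMn mulrn_int /=.
by rewrite modzMml divzK // -padic_compat.
Qed.
End Padic.

(** * Reversal of simplices *)

Section Reversal.
Variables (R : realType) (Y : topologicalType) (K : comPzRingType).
Local Notation sing n := (singular R Y n).
Local Notation C := (cochains R Y K).
Implicit Types a b c : C.

(* Meaningful only when f maps {0, ..., k} to {0, ..., n}. *)
Definition word n k (f : nat -> nat) (s : sing n) : sing k :=
  pull (fun j : 'I_k.+1 => inord (f j)) s.

Lemma eq_word n k f g (s : sing n) :
  (forall j, (j <= k)%N -> f j = g j) -> word k f s = word k g s.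
Proof.
move=> fg; congr (pull _ s); apply/funext => j; congr inord.
by rewrite fg // -ltnS.
Qed.

Lemma word_word n k l f g (s : sing n) : (forall j, (j <= l)%N -> (g j <= k)%N)
  ->
  word l g (word k f s) = word l (f \o g) s.
Proof.
move=> gk; rewrite /word pull_comp; congr (pull _ s); apply/funext => j /=.
by rewrite inordK // ltnS gk // -ltnS.
Qed.

Lemma word_id n f (s : sing n) : (forall j, (j <= n)%N -> f j = j) ->
  word n f s = s.
Proof. by move=> fE; apply: pull_id => j; rewrite fE -1?ltnS // inord_val. Qed.

Lemma face_word n (j : 'I_n.+2) (s : sing n.+1) : face j s = word n (bump j) s.
Proof.
congr (pull _ s); apply/funext => k; apply: val_inj => /=.
by rewrite inordK //; have := ltn_ord k; rewrite /bump; lia.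
Qed.

Lemma cochain_word a n k l f (s : sing n) : k = l ->
  a k (word k f s) = a l (word l f s).
Proof. by move->. Qed.

Fact reversal_subproof a : exists N, forall n, (N <= n)%N ->
  forall s : sing n, a n (word n (subn n) s) = 0.
Proof. by have [N aN] := cochain_bounded a; exists N => n Nn s; apply: aN. Qed.

(** No sign is inserted: reversal is then an exact anti-homomorphism for the cup product, and signs
    appear only in its relation to the coboundary. *)
Definition reversal a : C := Cochains (reversal_subproof a).

Lemma reversalK : involutive reversal.
Proof.
move=> a; apply: cochain_eq => n s /=; rewrite word_word => [|j]; last first.
  by rewrite leq_subr.
by rewrite word_id // => j jn /=; rewrite subKn.
Qed.

Lemma reversalM a b : reversal (a * b) = reversal b * reversal a.
Proof.
apply: cochain_eq => n s /=; rewrite /cup_fun /=.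
rewrite (reindex_inj rev_ord_inj) /=; apply: eq_bigr => i _.
have iN : (i <= n)%N by rewrite -ltnS.
rewrite subSS mulrC /segment -!/(word _ _ _) !word_word; try by move=> j; lia.
congr (_ * _).
  rewrite [LHS](@cochain_word b n _ i) ?subKn //; congr (b _ _).
  by apply: eq_word => j ji /=; lia.
by congr (a _ _); apply: eq_word => j ji /=; lia.
Qed.

(** Reversal exchanges the faces [j] and [n.+1 - j], whose signs differ by [(-1) ^+ n.+1]. *)
Lemma coboundary_reversal a :
  coboundary (reversal a) = cochain_sign (reversal (coboundary a)).
Proof.
apply: cochain_eq => -[|n] s /=; first by rewrite mulr0.
rewrite big_distrr (reindex_inj rev_ord_inj) /=; apply: eq_bigr => j _.
have jn : (j <= n.+1)%N by rewrite -ltnS.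
rewrite mulrA subSS; congr (_ * _).
  by rewrite -signr_odd oddB // signr_addb !signr_odd.
rewrite !face_word !word_word; try by move=> k; rewrite ?/bump; lia.
by congr (a _ _); apply: eq_word => k kn; rewrite /= /bump; lia.
Qed.

(* The sign with which reversal is homotopic to the identity in degree n. *)
Definition rev_sign n : K := (-1) ^+ 'C(n.+1, 2).

Lemma rev_signS n : rev_sign n.+1 = (-1) ^+ n.+1 * rev_sign n.
Proof. by rewrite /rev_sign binS bin1 exprD mulrC. Qed.

(* The vertices (v_0, ..., v_i, w_n, ..., w_i) of a simplex of the prism,     *)
(* projected back to the n-simplex.                                           *)
Definition prism n i j := (if j <= i then j else n + i + 1 - j)%N.

Fact prism_subproof a : exists N, forall n, (N <= n)%N -> forall s : sing n,
  \sum_(i < n.+1) (-1) ^+ i * rev_sign (n - i) * a n.+1 (word n.+1 (prism n i)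
    s)
  = 0.
Proof.
have [N aN] := cochain_bounded a; exists N => n Nn s.
by apply: big1 => i _; rewrite aN ?mulr0 // leqW.
Qed.

Definition prism_cochain a := Cochains (prism_subproof a).

(** The prism homotopy between the identity and signed reversal, evaluated on a cocycle. The cocycle
    relation on each prism simplex over [s] is summed: inner faces telescope, and the other faces
    are prism simplices over the faces of [s]. *)
Lemma coboundary_prism a n (s : sing n) : coboundary a = 0 ->
  coboundary (prism_cochain a) n s = rev_sign n * reversal a n s - a n s.
Proof.
move=> da; case: n s => [|n] s /=.
  rewrite mul1r (eq_word (g := id)) => [|j]; last by lia.
  by rewrite word_id // subrr.
(* The value on [(v_0, ..., v_(i-1), v_(n+1), ..., v_i)], a face shared by consecutive prism
   simplices; [D 0] is the reversed simplex and [D n.+2] the simplex itself. *)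
pose D i := a n.+1 (word n.+1 (fun k => if k < i then k else n.+1 + i - k)%N s).
pose c i : K := (-1) ^+ i * rev_sign (n.+1 - i).
(* [F] runs over the faces of the prism simplices over [s], [G] over the prism simplices of the
   faces of [s]. *)
pose F i j := c i * ((-1) ^+ j * a n.+1 (word n.+1 (prism n.+1 i \o bump j) s)).
pose G l i := (-1) ^+ l * ((-1) ^+ i * rev_sign (n - i) *
  a n.+1 (word n.+1 (bump l \o prism n i) s)).
have F0 i : (i < n.+2)%N -> \sum_(0 <= j < n.+3) F i j = 0.
  move=> iN; rewrite big_mkord -big_distrr /=.
  have := congr1 (fun b : C => b n.+2 (word n.+2 (prism n.+1 i) s)) da.
  rewrite /= (eq_bigr (fun j : 'I_n.+3 => (-1) ^+ j *
    a n.+1 (word n.+1 (prism n.+1 i \o bump j) s))) => [->|j _].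
    by rewrite mulr0.
  by rewrite face_word word_word // => k kn; rewrite /bump; lia.
have Fii i : (i < n.+2)%N -> F i i = rev_sign (n.+1 - i) * D i.
  move=> iN; rewrite /F /c mulrCA !mulrA -expr2 sqrr_sign mul1r.
  by congr (_ * a _ _); apply: eq_word => k kn; rewrite /= /prism /bump;
    do ?case: ifP => ?; lia.
have Flast i : (i < n.+2)%N -> F i n.+2 =
    - ((if (i < n.+1)%N then rev_sign (n.+1 - i.+1) else 1) * D i.+1).
  move=> iN; rewrite /F mulrA -mulNr; congr (_ * _); last first.
    by congr (a _ _); apply: eq_word => k kn; rewrite /= /prism /bump;
      do ?case: ifP => ?; lia.
  rewrite /c; case: ltnP => iN'.
    rewrite subSS subSn // rev_signS mulrA -exprD mulrAC -exprD.
    by rewrite -signr_odd (_ : odd _ = true) ?mulN1r //; lia.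
  have -> : i = n.+1 by lia.
  by rewrite subnn mulr1 -exprD -signr_odd oddD /=; case: (odd n).
have FGlow i l : (l <= i < n.+1)%N -> F i.+1 l = - G l i.
  move=> lin; rewrite /F /G /c subSS exprS mulN1r !mulNr !mulrA.
  congr (- (_ * _)); first by rewrite mulrC mulrA.
  by congr (a _ _); apply: eq_word => k kn; rewrite /= /prism /bump;
    do ?case: ifP => ?; lia.
have FGhigh i l : (i < l < n.+2)%N -> F i (n.+2 + i - l)%N = - G l i.
  move=> iln; rewrite /F /G /c subSn; last by lia.
  rewrite rev_signS !mulrA -mulNr; congr (_ * _); last first.
    by congr (a _ _); apply: eq_word => k kn; rewrite /= /prism /bump;
      do ?case: ifP => ?; lia.
  move: (rev_sign _) => X.
  rewrite -!exprD mulrAC -exprD -[RHS]mulN1r mulrA -exprS; congr (_ * _).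
  by rewrite -[LHS]signr_odd -[RHS]signr_odd; congr (_ ^+ _); lia.
(* [e i] is the sign carried by [D i]. [L i] and [M i] collect the faces of the [i]-th prism simplex
   before and after the one giving [D i], the last face excepted. *)
pose e i : K := if (i < n.+2)%N then rev_sign (n.+1 - i) else 1.
pose L i := \sum_(0 <= j < i) F i j.
pose M i := \sum_(i.+1 <= j < n.+2) F i j.
have split i : (0 <= i < n.+2)%N -> L i + M i = e i.+1 * D i.+1 - e i * D i.
  move=> iN; have := F0 i iN;
    rewrite big_nat_recr // (@big_cat_nat _ _ _ i) //=.
    rewrite [X in _ + X + _]big_ltn // Flast // Fii // => /subr0_eq.
    rewrite -/(L i) -/(M i) addrCA => QE.
    have -> : e i.+1 * D i.+1 = rev_sign (n.+1 - i) * D i + (L i + M i) by [].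
    by rewrite /e (iN : (i < n.+2)%N) addrAC subrr add0r.
  by lia.
have LM : \sum_(0 <= i < n.+2) (L i + M i) =
    - \sum_(0 <= i < n.+1) \sum_(0 <= l < n.+2) G l i.
  rewrite big_split /= big_nat_recl // [L 0%N]big_geq // add0r.
  rewrite [X in _ + X]big_nat_recr //= [M n.+1]big_geq // addr0 -big_split
    -sumrN /=.
  apply: eq_big_nat => i iN.
  rewrite [in RHS](@big_cat_nat _ _ _ i.+1) //= ?opprD -?sumrN; last by lia.
  congr (_ + _); first by apply: eq_big_nat => l lN; apply: FGlow; lia.
  rewrite /M big_nat_rev /=; apply: eq_big_nat => l lN.
  by rewrite -FGhigh //; congr (F i _); lia.
have DE : D 0%N = a n.+1 (word n.+1 (subn n.+1) s).
  by congr (a _ _); apply: eq_word => k kn /=; lia.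
have Ds : D n.+2 = a n.+1 s.
  by congr (a _ _); apply: word_id => k kn; case: ifP => ?; lia.
transitivity (\sum_(0 <= i < n.+1) \sum_(0 <= l < n.+2) G l i).
  rewrite big_mkord; under [RHS]eq_bigr do rewrite big_mkord.
  rewrite exchange_big /=; apply: eq_bigr => l _; rewrite big_distrr /=.
  apply: eq_bigr => i _; rewrite face_word word_word // => k kn.
  by have := ltn_ord i; rewrite /prism; case: ifP => ?; lia.
apply: oppr_inj; rewrite -LM (eq_big_nat _ _ split) telescope_sumr //.
by rewrite opprB /e ltnn subn0 mul1r DE Ds.
Qed.
End Reversal.

Lemma coboundary_coboundary (R : realType) (Y : topologicalType)
    (K : comPzRingType) (a : cochains R Y K) :
  coboundary (coboundary a) = 0.
Proof.
apply: cochain_eq => -[|[|n]] s //=; first by apply: big1 => j _; rewrite mulr0.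
pose G i j := (-1) ^+ (i + j) * a n (word n (bump i \o bump j) s).
transitivity (\sum_(i < n.+3) \sum_(j < n.+2) G i j).
  apply: eq_bigr => i _; rewrite big_distrr; apply: eq_bigr => j _ /=.
  rewrite mulrA -exprD !face_word word_word // => k kn; rewrite /bump; lia.
(* Omitting two vertices in either order gives the same face with opposite signs. *)
have GN i j : (j <= i)%N -> G i.+1 j = - G j i.
  move=> ji; rewrite /G addSn exprS mulN1r mulNr [(i + j)%N]addnC.
  by congr (- (_ * a _ _)); apply: eq_word => k kn; rewrite /= /bump; lia.
transitivity (\sum_(i < n.+3) \sum_(j < n.+2 | (j < i)%N) G i j +
              \sum_(i < n.+3) \sum_(j < n.+2 | (i <= j)%N) G i j).
  rewrite -big_split; apply: eq_bigr => i _ /=.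
  rewrite (bigID (fun j : 'I_n.+2 => (j < i)%N)) /=; congr (_ + _).
  by apply: eq_bigl => j; rewrite -leqNgt.
rewrite big_ord_recl big_pred0 // add0r.
rewrite [X in _ + X]big_ord_recr /= [X in _ + (_ + X)]big_pred0 => [|j];
  last first.
  by rewrite leqNgt ltn_ord.
rewrite addr0 (exchange_big_dep xpredT) //= -big_split big1 // => j _ /=.
rewrite -big_split big1 // => i /= ji.
by rewrite GN ?addNr.
Qed.

(** * Cohomology classes *)

Section CochainTheory.
Variables (R : realType) (Y : topologicalType) (K : comPzRingType).
Local Notation sing n := (singular R Y n).
Local Notation C := (cochains R Y K).
Implicit Types a b c : C.

Lemma coboundary0 : coboundary (0 : C) = 0.
Proof. by rewrite -[X in coboundary X](subrr 0) coboundaryB subrr. Qed.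

Lemma coboundaryN a : coboundary (- a) = - coboundary a.
Proof. by rewrite -[X in coboundary X]sub0r coboundaryB coboundary0 sub0r. Qed.

Lemma coboundaryD a b : coboundary (a + b) = coboundary a + coboundary b.
Proof. by rewrite -{1}[b]opprK coboundaryB coboundaryN opprK. Qed.

Lemma coboundaryMn a k : coboundary (a *+ k) = coboundary a *+ k.
Proof.
by elim: k => [|k IH]; rewrite ?mulr0n ?coboundary0 // !mulrS coboundaryD IH.
Qed.

Lemma cochainMn a k n (s : sing n) : (a *+ k) n s = a n s *+ k.
Proof. by elim: k => [|k IH]; [rewrite !mulr0n | rewrite !mulrS /= IH]. Qed.

(** A cochain must vanish in high degrees, so pointwise choice is overridden by 0 from degree [N]
    on. *)
Lemma cochain_choice (P : forall n, sing n -> K -> Prop) N :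
  (forall n s, exists x, @P n s x) ->
  (forall n s, (N <= n)%N -> @P n s 0) ->
  exists a, forall n s, @P n s (a n s).
Proof.
move=> Pex P0.
have PN n : exists f : sing n -> K, forall s, P n s (f s) /\
    ((N <= n)%N -> f s = 0).
  have [Nn|nN] := leqP N n.
    by exists (fun=> 0) => s; split=> //; apply: P0.
  by have [f fP] := choice (Pex n); exists f.
pose f n := sval (cid (PN n)).
have fP n s : P n s (f n s) /\ ((N <= n)%N -> f n s = 0).
  exact: (svalP (cid (PN n)) s).
have fN : exists N, forall n, (N <= n)%N -> forall s, f n s = 0.
  by exists N => n Nn s; have [_] := fP n s; apply.
by exists (Cochains fN) => n s /=; have [] := fP n s.
Qed.

Fact cochain_component_subproof d a : exists N, forall n, (N <= n)%N ->
  forall s : sing n, (if n == d then a n s else 0) = 0.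
Proof.
by have [N aN] := cochain_bounded a; exists N => n Nn s; rewrite aN // if_same.
Qed.

Definition cochain_component d a : C := Cochains (cochain_component_subproof d
  a).

Lemma cochain_componentB d : {morph cochain_component d : a b / a - b}.
Proof.
by move=> a b; apply: cochain_eq => n s /=; case: eqP => // _; rewrite subr0.
Qed.

Lemma cochain_component_component m n a :
  cochain_component m (cochain_component n a) =
  if m == n then cochain_component n a else 0.
Proof.
apply: cochain_eq => k s; have [->|mn] := eqVneq m n => /=; first by case: eqP.
by have [km|//] := eqVneq k m; rewrite [k == n]negbTE // km.
Qed.

Lemma coboundary_component n a :
  coboundary (cochain_component n a) = cochain_component n.+1 (coboundary a).
Proof.
apply: cochain_eq => -[|m] s //=; rewrite eqSS; case: eqP => // _.
by rewrite big1 // => j _; rewrite mulr0.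
Qed.

Lemma component0_coboundary a : cochain_component 0 (coboundary a) = 0.
Proof. by apply: cochain_eq => -[|n] s. Qed.

Lemma cochain_component_sum a : exists N, a = \sum_(n < N) cochain_component n
  a.
Proof.
have [N aN] := cochain_bounded a; exists N; apply: cochain_eq => m s.
have sumE (r : seq 'I_N) : (\sum_(n <- r) cochain_component n a : C) m s =
    \sum_(n <- r) cochain_component n a m s.
  by elim: r => [|n r IH]; rewrite ?big_nil // !big_cons /= IH.
rewrite sumE /=; have [mN|Nm] := ltnP m N; last first.
  by rewrite aN // big1 // => n _; rewrite if_same.
rewrite (bigD1 (Ordinal mN)) //= eqxx big1 ?addr0 // => n.
by rewrite -val_eqE /= eq_sym => /negPf ->.
Qed.

Lemma cochain_componentM n a b : cochain_component n (a * b) =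
  \sum_(k < n.+1) cochain_component k a * cochain_component (n - k)%N b.
Proof.
apply: cochain_eq => m s.
have sumE (r : seq 'I_n.+1) (f : 'I_n.+1 -> C) :
    (\sum_(k <- r) f k) m s = \sum_(k <- r) f k m s.
  by elim: r => [|k r IH]; rewrite ?big_nil // !big_cons /= IH.
rewrite sumE /= /cup_fun /=; case: eqP => [mn|mn]; last first.
  rewrite big1 // => k _; rewrite big1 // => i _.
  case: eqP => [ik|]; last by rewrite mul0r.
  case: eqP => [mk|]; last by rewrite mulr0.
  by have := ltn_ord i; have := ltn_ord k; lia.
move: mn => /= mn; subst n; rewrite exchange_big /=; apply: eq_bigr => i _.
rewrite (bigD1 i) //= !eqxx big1 ?addr0 // => k.
by rewrite -val_eqE /= eq_sym => /negPf ->; rewrite mul0r.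
Qed.
End CochainTheory.

Section CohomologyClasses.
Variables (R : realType) (Y : topologicalType) (K : comPzRingType).
Local Notation C := (cochains R Y K).
Local Notation H := (cohomology R Y K).
Implicit Types a b c : C.

(* Cochains that are not cocycles are sent to 0. *)
Definition cclass a : H := \pi_(cohomology R Y K) (insubd (0 : cocycles R Y K)
  a).

Lemma cclass_val z : cclass (val z) = \pi_(cohomology R Y K) z.
Proof. by rewrite /cclass valKd. Qed.

Lemma cocycle_ind (P : C -> Prop) :
  (forall z : cocycles R Y K, P (val z)) -> forall a, coboundary a = 0 -> P a.
Proof. by move=> Pz a /cocycleP az; apply: (Pz (Cocycles az)). Qed.

Lemma cclassP x : exists2 a, coboundary a = 0 & cclass a = x.
Proof.
exists (val (repr x)); first by apply/cocycleP/valP.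
by rewrite cclass_val reprK.
Qed.

Lemma cclass_eq a b : coboundary a = 0 -> coboundary b = 0 ->
  (cclass a = cclass b <-> exists u, a - b = coboundary u).
Proof.
move: a; apply: cocycle_ind => y; move: b; apply: cocycle_ind => z.
rewrite !cclass_val -raddfB; split=> [/eqP|yz].
  by rewrite cohomology_pi_eq => /is_coboundaryP.
by apply/eqP; rewrite cohomology_pi_eq; apply/is_coboundaryP.
Qed.

Lemma cclassB a b : coboundary a = 0 -> coboundary b = 0 ->
  cclass (a - b) = cclass a - cclass b.
Proof.
move: a; apply: cocycle_ind => y; move: b; apply: cocycle_ind => z.
by rewrite -raddfB !cclass_val raddfB.
Qed.

Lemma cclassM a b : coboundary a = 0 -> coboundary b = 0 ->
  cclass (a * b) = cclass a * cclass b.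
Proof.
move: a; apply: cocycle_ind => y; move: b; apply: cocycle_ind => z.
by rewrite -rmorphM !cclass_val cohomology_piM.
Qed.

Lemma cclass0 : cclass 0 = 0.
Proof. by have := cclass_val 0; rewrite raddf0 => ->; rewrite raddf0. Qed.

Lemma cclass1 : cclass 1 = 1.
Proof. by have := cclass_val 1; rewrite rmorph1. Qed.

Lemma cclassD a b : coboundary a = 0 -> coboundary b = 0 ->
  cclass (a + b) = cclass a + cclass b.
Proof.
move: a; apply: cocycle_ind => y; move: b; apply: cocycle_ind => z.
by rewrite -raddfD !cclass_val raddfD.
Qed.

Lemma cclassMn a k : coboundary a = 0 -> cclass (a *+ k) = cclass a *+ k.
Proof.
move=> da; elim: k => [|k IH]; first by rewrite !mulr0n cclass0.
by rewrite !mulrS cclassD ?IH // coboundaryMn da mul0rn.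
Qed.

Lemma cocycleM a b : coboundary a = 0 -> coboundary b = 0 ->
  coboundary (a * b) = 0.
Proof.
move: a; apply: cocycle_ind => y; move: b; apply: cocycle_ind => z.
by rewrite -rmorphM; apply/cocycleP/valP.
Qed.

Lemma cclass_sum n (f : nat -> C) : (forall i, coboundary (f i) = 0) ->
  coboundary (\sum_(i < n) f i) = 0 /\
  cclass (\sum_(i < n) f i) = \sum_(i < n) cclass (f i).
Proof.
move=> df; elim: n => [|n [dn IH]];
  first by rewrite !big_ord0 coboundary0 cclass0.
by rewrite !big_ord_recr /= cclassD ?IH // coboundaryD dn df addr0.
Qed.
End CohomologyClasses.

(** * Maps induced on cohomology *)

Section InducedMaps.
Variables (R : realType) (Y : topologicalType) (K L : comPzRingType).

(** Weaker than commuting with the coboundary, in order to cover projections to one degree, which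
    shift it, and the sign and reversal maps, which commute with it only up to sign. *)
Definition cohomological (f : cochains R Y K -> cochains R Y L) :=
  [/\ {morph f : a b / a - b}, forall a, coboundary a = 0 -> coboundary (f a) =
    0 &
      forall u, exists v, f (coboundary u) = coboundary v].

Definition cohomology_map (f : cochains R Y K -> cochains R Y L)
  (x : cohomology R Y K) : cohomology R Y L := cclass (f (val (repr x))).

Variable f : cochains R Y K -> cochains R Y L.
Hypothesis f_coh : cohomological f.

Lemma cohomology_mapE a : coboundary a = 0 ->
  cohomology_map f (cclass a) = cclass (f a).
Proof.
have [fB fZ fD] := f_coh; move=> da; rewrite /cohomology_map.
set b := val _; have db : coboundary b = 0 by apply/cocycleP/valP.
apply/cclass_eq; [exact: fZ | exact: fZ|].
have [u bau] : exists u, b - a = coboundary u.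
  by apply/cclass_eq => //; rewrite cclass_val reprK.
by have [v fv] := fD u; exists v; rewrite -fB bau.
Qed.

Lemma cohomology_mapB : {morph cohomology_map f : x y / x - y}.
Proof.
have [fB fZ _] := f_coh.
move=> x y; have [a da <-] := cclassP x; have [b db <-] := cclassP y.
rewrite -cclassB // !cohomology_mapE // ?fB ?cclassB //; try exact: fZ.
by rewrite coboundaryB da db subrr.
Qed.

Lemma cohomology_mapD : {morph cohomology_map f : x y / x + y}.
Proof.
have f0 : cohomology_map f 0 = 0 by rewrite -(subrr 0) cohomology_mapB subrr.
move=> x y; rewrite -{1}[y]opprK cohomology_mapB -[- y]sub0r cohomology_mapB f0.
by rewrite sub0r opprK.
Qed.
End InducedMaps.

(** * Grading, reversal and commutativity of the cohomology ring *)

Section CohomologyRing.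
Variables (R : realType) (Y : topologicalType) (K : comPzRingType).
Local Notation sing n := (singular R Y n).
Local Notation C := (cochains R Y K).
Local Notation H := (cohomology R Y K).
Implicit Types a b c : C.

Lemma cochain_component0 d : cochain_component d (0 : C) = 0.
Proof. by rewrite -[X in cochain_component d X](subrr 0) cochain_componentB
  subrr. Qed.

Lemma cocycle_component d a : coboundary a = 0 ->
  coboundary (cochain_component d a) = 0.
Proof. by move=> da; rewrite coboundary_component da cochain_component0. Qed.

Lemma component_cohomological d :
  cohomological (cochain_component d : C -> C).
Proof.
split=> [|a|u]; [exact: cochain_componentB | exact: cocycle_component |].
case: d => [|d]; last by exists (cochain_component d u);
  rewrite coboundary_component.
by exists 0; rewrite component0_coboundary coboundary0.
Qed.

Definition cohomology_component d : H -> H := cohomology_map (cochain_component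
  d).

Lemma cclass_component d a : coboundary a = 0 ->
  cohomology_component d (cclass a) = cclass (cochain_component d a).
Proof. by move=> da; apply: cohomology_mapE => //;
  apply: component_cohomological. Qed.

Lemma cohomology_componentD d : {morph cohomology_component d : x y / x + y}.
Proof. exact/cohomology_mapD/component_cohomological. Qed.

Lemma cohomology_component_component m n x :
  cohomology_component m (cohomology_component n x) =
  if m == n then cohomology_component n x else 0.
Proof.
have [a da <-] := cclassP x.
rewrite !cclass_component //; last exact: cocycle_component.
by rewrite cochain_component_component; case: ifP => // _; rewrite cclass0.
Qed.

Lemma cohomology_component_sum x :
  exists N, x = \sum_(n < N) cohomology_component n x.
Proof.
have [a da <-] := cclassP x; have [N aN] := cochain_component_sum a; exists N.
rewrite {1}aN; have [_ ->] := cclass_sum N (fun n => cocycle_component n da).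
by apply: eq_bigr => n _; rewrite cclass_component.
Qed.

Lemma cohomology_componentM n x y : cohomology_component n (x * y) =
  \sum_(k < n.+1) cohomology_component k x * cohomology_component (n - k)%N y.
Proof.
have [a da <-] := cclassP x; have [b db <-] := cclassP y.
rewrite -cclassM // cclass_component ?cocycleM // cochain_componentM.
have dab k := cocycleM (cocycle_component k da) (cocycle_component (n - k)%N
  db).
have [_ ->] := cclass_sum n.+1 dab; apply: eq_bigr => k _.
by rewrite cclassM ?cclass_component //; apply: cocycle_component.
Qed.

Definition cohomology_grading : grading H :=
  Grading cohomology_componentD cohomology_component_component
    cohomology_component_sum cohomology_componentM.

Lemma homogeneous_cclass d x : cohomology_grading d x = x ->
  exists a, [/\ coboundary a = 0, cochain_component d a = a & cclass a = x].
Proof.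
have [a da <-] := cclassP x => /= xd.
exists (cochain_component d a); split; first exact: cocycle_component.
  by rewrite cochain_component_component eqxx.
by rewrite -cclass_component.
Qed.

Lemma cochain_signB : {morph (@cochain_sign R Y K) : a b / a - b}.
Proof. by move=> a b; apply: cochain_eq => n s /=; rewrite mulrBr. Qed.

Lemma cochain_sign0 : cochain_sign (0 : C) = 0.
Proof. by rewrite -[X in cochain_sign X](subrr 0) cochain_signB subrr. Qed.

Lemma sign_cohomological : cohomological (@cochain_sign R Y K).
Proof.
split=> [|a da|u]; first exact: cochain_signB.
  by rewrite coboundary_sign da cochain_sign0 oppr0.
by exists (- cochain_sign u); rewrite coboundaryN coboundary_sign opprK.
Qed.

Lemma reversalB : {morph (@reversal R Y K) : a b / a - b}.
Proof. by move=> a b; apply: cochain_eq. Qed.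

Lemma reversal_cohomological : cohomological (@reversal R Y K).
Proof.
split=> [|a da|u]; first exact: reversalB.
  rewrite coboundary_reversal da (_ : reversal 0 = 0) ?cochain_sign0 //.
  by rewrite -[X in reversal X](subrr 0) reversalB subrr.
exists (- cochain_sign (reversal u)).
by rewrite coboundaryN coboundary_sign opprK coboundary_reversal cochain_signK.
Qed.

Definition cohomology_reversal : H -> H := cohomology_map (@reversal R Y K).

Lemma cclass_reversal a : coboundary a = 0 ->
  cohomology_reversal (cclass a) = cclass (reversal a).
Proof. by move=> da; apply: cohomology_mapE => //;
  apply: reversal_cohomological. Qed.

Lemma cocycle_reversal a : coboundary a = 0 -> coboundary (reversal a) = 0.
Proof. by have [_ + _] := reversal_cohomological; apply. Qed.

Lemma cohomology_reversalM x y : cohomology_reversal (x * y) =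
  cohomology_reversal y * cohomology_reversal x.
Proof.
have [a da <-] := cclassP x; have [b db <-] := cclassP y.
rewrite -cclassM // !cclass_reversal ?cocycleM //.
by rewrite reversalM cclassM //; apply: cocycle_reversal.
Qed.

Lemma noetherian_cohomology : noetherian H <-> left_noetherian H.
Proof.
split=> [[]//|Hn]; split=> //.
apply: (left_noetherian_anti (tau := cohomology_reversal)) => //.
- move=> x; have [a da <-] := cclassP x.
  by rewrite !cclass_reversal ?reversalK //; apply: cocycle_reversal.
- exact/cohomology_mapD/reversal_cohomological.
- exact: cohomology_reversalM.
Qed.

Lemma rev_signE n : rev_sign K n = 1 \/ rev_sign K n = -1.
Proof.
by rewrite /rev_sign -signr_odd; case: odd; [right | left].
Qed.

(** The prism homotopy gives the sign [rev_sign K d], constant on a representative concentrated in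
    degree [d]. *)
Lemma cohomology_reversal_homogeneous x : homogeneous cohomology_grading x ->
  cohomology_reversal x = x \/ cohomology_reversal x = - x.
Proof.
case=> d /homogeneous_cclass[a [da ad <-]]; rewrite cclass_reversal //.
have dr := cocycle_reversal da.
have ra n (s : sing n) : rev_sign K n * reversal a n s =
    rev_sign K d * reversal a n s.
  have [nd|nd] := eqVneq n d; first by congr (rev_sign K _ * _).
  by rewrite -ad /= (negPf nd) !mulr0.
have [e1|e1] := rev_signE d; [left | right].
  apply/cclass_eq => //; exists (prism_cochain a); apply: cochain_eq => n s.
  by rewrite (coboundary_prism _ da) ra e1 mul1r.
rewrite -[RHS]sub0r -(cclass0 R Y K) -cclassB ?coboundary0 // sub0r.
apply/cclass_eq; rewrite ?coboundaryN ?da ?oppr0 //.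
exists (- prism_cochain a); apply: cochain_eq => n s.
rewrite coboundaryN -[RHS]/(- coboundary (prism_cochain a) n s).
rewrite (coboundary_prism _ da) ra e1 mulN1r opprB !opprK.
exact: addrC.
Qed.

(** Reversal fixes [x], [y] and [x * y] up to sign and reverses products, so [x * y] and [y * x]
    agree up to sign. *)
Lemma cohomology_commutative x y : homogeneous cohomology_grading x ->
  homogeneous cohomology_grading y -> x * y = y * x \/ x * y = - (y * x).
Proof.
move=> hx hy; have hxy : homogeneous cohomology_grading (x * y).
  have [[m xm] [n yn]] := (hx, hy); exists (m + n)%N.
  by rewrite (componentM_homogl _ _ xm) leq_addr addKn yn.
have := cohomology_reversalM x y.
have [->|->] := cohomology_reversal_homogeneous hx;
have [->|->] := cohomology_reversal_homogeneous hy;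
have [->|->] := cohomology_reversal_homogeneous hxy;
rewrite ?mulNr ?mulrN ?opprK => xyE; try by [left | right].
- by right; rewrite -xyE opprK.
- by left; apply: oppr_inj.
- by left; apply: oppr_inj.
- by right; rewrite -xyE opprK.
Qed.
End CohomologyRing.

(** * Change of coefficients *)

Section CoefficientChange.
Variables (R : realType) (Y : topologicalType) (K L : comPzRingType).
Variable phi : {rmorphism K -> L}.
Local Notation sing n := (singular R Y n).
Implicit Types a b : cochains R Y K.

Fact cochain_map_subproof a : exists N, forall n, (N <= n)%N ->
  forall s : sing n, phi (a n s) = 0.
Proof.
by have [N aN] := cochain_bounded a; exists N => n Nn s; rewrite aN ?rmorph0.
Qed.

Definition cochain_map a : cochains R Y L := Cochains (cochain_map_subproof a).

Lemma cochain_mapB : {morph cochain_map : a b / a - b}.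
Proof. by move=> a b; apply: cochain_eq => n s /=; rewrite rmorphB. Qed.

Lemma cochain_map1 : cochain_map 1 = 1.
Proof. by apply: cochain_eq => n s /=; rewrite rmorph_nat. Qed.

Lemma cochain_mapM : {morph cochain_map : a b / a * b}.
Proof.
move=> a b; apply: cochain_eq => n s /=; rewrite /cup_fun rmorph_sum.
by apply: eq_bigr => i _; rewrite rmorphM.
Qed.

Lemma coboundary_map a : coboundary (cochain_map a) = cochain_map (coboundary
  a).
Proof.
apply: cochain_eq => -[|n] s /=; first by rewrite rmorph0.
by rewrite rmorph_sum; apply: eq_bigr => j _; rewrite rmorphM rmorph_sign.
Qed.

Lemma component_map d a :
  cochain_component d (cochain_map a) = cochain_map (cochain_component d a).
Proof. by apply: cochain_eq => n s /=; case: ifP => // _; rewrite rmorph0. Qed.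

Lemma sign_map a : cochain_sign (cochain_map a) = cochain_map (cochain_sign a).
Proof. by apply: cochain_eq => n s /=; rewrite rmorphM rmorph_sign. Qed.

Lemma cochain_map0 : cochain_map 0 = 0.
Proof. by rewrite -[X in cochain_map X](subrr 0) cochain_mapB subrr. Qed.

Lemma cocycle_map a : coboundary a = 0 -> coboundary (cochain_map a) = 0.
Proof. by move=> da; rewrite coboundary_map da cochain_map0. Qed.

Lemma map_cohomological : cohomological cochain_map.
Proof.
split=> [|a|u]; [exact: cochain_mapB | exact: cocycle_map |].
by exists (cochain_map u); rewrite coboundary_map.
Qed.

Definition coefficient_map : cohomology R Y K -> cohomology R Y L :=
  cohomology_map cochain_map.

Lemma coefficient_mapE a : coboundary a = 0 ->
  coefficient_map (cclass a) = cclass (cochain_map a).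
Proof. by move=> da; apply: cohomology_mapE => //;
  apply: map_cohomological. Qed.

Fact coefficient_map_zmod_morphism : zmod_morphism coefficient_map.
Proof. exact/cohomology_mapB/map_cohomological. Qed.

Fact coefficient_map_monoid_morphism : monoid_morphism coefficient_map.
Proof.
split=> [|x y].
  by rewrite -(cclass1 R Y K) coefficient_mapE ?coboundary1 // cochain_map1
    cclass1.
have [a da <-] := cclassP x; have [b db <-] := cclassP y.
rewrite -cclassM // !coefficient_mapE ?cocycleM //.
by rewrite cochain_mapM cclassM //; apply: cocycle_map.
Qed.

HB.instance Definition _ := GRing.isZmodMorphism.Build _ _ coefficient_map
  coefficient_map_zmod_morphism.
HB.instance Definition _ := GRing.isMonoidMorphism.Build _ _ coefficient_map
  coefficient_map_monoid_morphism.

Lemma coefficient_map_component n x :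
  coefficient_map (cohomology_grading R Y K n x) =
  cohomology_grading R Y L n (coefficient_map x).
Proof.
have [a da <-] := cclassP x; rewrite /= cclass_component //.
rewrite !coefficient_mapE ?cocycle_component // cclass_component ?component_map
  //.
exact: cocycle_map.
Qed.
End CoefficientChange.

(** * Reduction modulo p *)

Section PadicCohomology.
Variables (R : realType) (Y : topologicalType) (p : nat).
Hypothesis p_prime : prime p.
Local Notation sing n := (singular R Y n).
Local Notation Cp := (cochains R Y (padic p)).
Local Notation Hp := (cohomology R Y (padic p)).
Local Notation CF := (cochains R Y 'F_p).
Local Notation HF := (cohomology R Y 'F_p).

HB.instance Definition _ := GRing.isZmodMorphism.Build (padic p) 'F_p
  (@padic_red p) (padic_red_zmod_morphism p_prime).
HB.instance Definition _ := GRing.isMonoidMorphism.Build (padic p) 'F_p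
  (@padic_red p) (padic_red_monoid_morphism p_prime).

Let red : Cp -> CF := cochain_map (@padic_red p).
Let r : {rmorphism Hp -> HF} := coefficient_map (@padic_red p).

Lemma cochain_lift (b : CF) : exists a, red a = b.
Proof.
have [N bN] := cochain_bounded b.
have [n s|n s Nn|a aP] := cochain_choice (K := padic p) (N := N)
    (P := fun n s x => padic_red x = b n s).
- by exists (padic_lift (b n s)); rewrite padic_liftK.
- by rewrite bN // rmorph0.
- by exists a; apply: cochain_eq.
Qed.

Lemma red_eq0 (a : Cp) : red a = 0 -> exists b, a = b *+ p.
Proof.
move=> a0; have [N aN] := cochain_bounded a.
have [n s|n s Nn|b bP] := cochain_choice (K := padic p) (N := N)
    (P := fun n s x => a n s = x *+ p).
- by apply: (padic_red_eq0 p_prime); have := congr1 (fun b : CF => b n s) a0.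
- by rewrite aN // mul0rn.
- by exists b; apply: cochain_eq => n s; rewrite cochainMn.
Qed.

Lemma padic_cochain_torsion_free k (a : Cp) : a *+ p ^ k = 0 -> a = 0.
Proof.
move=> a0; apply: cochain_eq => n s;
  apply: (padic_torsion_free p_prime (k := k)).
by rewrite -cochainMn a0.
Qed.

Lemma padic_cochain_separated (a : Cp) :
  (forall n, exists b, a = b *+ p ^ n) -> a = 0.
Proof.
move=> ap; apply: cochain_eq => n s; apply: padic_separated => k.
by have [b ->] := ap k; exists (b n s); rewrite cochainMn.
Qed.

(** Each term is infinitely divisible by p. Applied to the defect of an identity between tails of
    p-adic series, this makes the identity exact. *)
Lemma shift_separated (a : nat -> Cp) :
  (forall i, a i = a i.+1 *+ p) -> forall i, a i = 0.
Proof.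
move=> ap i; apply: padic_cochain_separated => n; exists (a (i + n)%N).
elim: n => [|n IH]; first by rewrite addn0 mulr1n.
by rewrite IH ap -mulrnA -expnS addnS.
Qed.

Lemma red_Mp k (a : Cp) : red (a *+ p ^ k.+1) = 0.
Proof.
apply: cochain_eq => n s /=; rewrite cochainMn rmorphMn /=.
by rewrite expnS mulrnA (mulrn_pchar (pchar_Fp p_prime)) mul0rn.
Qed.

Lemma red_p (a : Cp) : red (a *+ p) = 0.
Proof. exact: (red_Mp 0 a). Qed.

Lemma redB (a b : Cp) : red (a - b) = red a - red b.
Proof. exact: cochain_mapB. Qed.

(** The coboundary of [v] times [p ^ k] is a double coboundary, and p-adic cochains have no
    p-torsion. *)
Lemma cocycle_divided k (v w : Cp) : coboundary w = v *+ p ^ k -> coboundary v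
  = 0.
Proof.
move=> wv; apply: (@padic_cochain_torsion_free k).
by rewrite -coboundaryMn -wv coboundary_coboundary.
Qed.

(** The uniform bound [N] on the degrees makes the pointwise sums cochains again. *)
Lemma cochain_series (z : nat -> Cp) N :
  (forall i n (s : sing n), (N <= n)%N -> z i n s = 0) ->
  exists y : nat -> Cp, forall i, y i = z i + y i.+1 *+ p.
Proof.
move=> zN.
have yP n (s : sing n) : exists y : nat -> padic p,
    (forall i, y i = z i n s + y i.+1 *+ p) /\ ((N <= n)%N -> forall i, y i =
      0).
  have [Nn|nN] := leqP N n.
    by exists (fun=> 0); split=> // i; rewrite zN // mul0rn addr0.
  by have [y yE] := padic_series (fun i => z i n s); exists y.
pose y n s := sval (cid (yP n s)).
have y_P n s : _ /\ _ := svalP (cid (yP n s)).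
have yN i : exists N, forall n, (N <= n)%N -> forall s : sing n, y n s i = 0.
  by exists N => n Nn s; have [_ y0] := y_P n s; apply: y0.
exists (fun i => Cochains (yN i)) => i; apply: cochain_eq => n s.
rewrite -[RHS]/(z i n s + (Cochains (yN i.+1) *+ p) n s) cochainMn /=.
by have [yE _] := y_P n s; apply: yE.
Qed.

(** Homogeneous cocycles representing the terms are summed as cochains. The coboundaries of the
    tails satisfy the recursion of [shift_separated], so the tails are cocycles. *)
Lemma cohomology_complete k (x : nat -> Hp) :
  (forall i, cohomology_grading R Y (padic p) k (x i) = x i) ->
  exists b, forall n, exists y, b = \sum_(i < n) x i *+ p ^ i + y *+ p ^ n.
Proof.
move=> xk; have [z zP] := choice (fun i => homogeneous_cclass (xk i)).
have dz i : coboundary (z i) = 0 by have [] := zP i.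
have [i n s kn|y yE] := @cochain_series z k.+1.
  by have [_ <- _] := zP i; rewrite /= gtn_eqF.
have dy i : coboundary (y i) = 0.
  move: i; apply: shift_separated => i.
  by rewrite {1}yE coboundaryD dz add0r coboundaryMn.
exists (cclass (y 0%N)) => n; exists (cclass (y n)).
elim: n => [|n ->]; first by rewrite big_ord0 add0r.
rewrite big_ord_recr /= -addrA; congr (_ + _).
rewrite {1}yE cclassD ?coboundaryMn ?dy ?mul0rn // cclassMn //.
by have [_ _ ->] := zP n; rewrite mulrnDl expnS mulrnA.
Qed.

Lemma homogeneous_coboundary k (a u : Cp) : cochain_component k a = a ->
  a = coboundary u -> exists2 w, a = coboundary w &
    forall n (s : sing n), (k < n)%N -> w n s = 0.
Proof.
move=> ak au; case: k ak => [|k] ak.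
  by exists 0; rewrite // coboundary0 -ak au component0_coboundary.
exists (cochain_component k u); first by rewrite coboundary_component -au.
by move=> n s kn /=; rewrite gtn_eqF // ltnW.
Qed.

(** Quotients of a homogeneous class by [p ^ n] are compatible only up to torsion. Multiplied by
    [p ^ d] they form an exact chain [X i = X i.+1 *+ p] starting at the class. For representing
    cocycles the defects of this chain are coboundaries, and the p-adic sum of their primitives
    bounds the first cocycle. *)
Lemma cohomology_separated (x : Hp) : bounded_torsion p Hp ->
  (forall n, exists y, x = y *+ p ^ n) -> x = 0.
Proof.
case=> d torsion xp.
suff hom k x' : cohomology_grading R Y (padic p) k x' = x' ->
    (forall n, exists y, x' = y *+ p ^ n) -> x' = 0.
  have [N ->] := component_sum (cohomology_grading R Y (padic p)) x.
  rewrite big1 // => n _; apply: (hom n);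
    first by rewrite component_component eqxx.
  move=> m; have [y ->] := xp m.
  by exists (cohomology_grading R Y (padic p) n y); rewrite componentMn.
move=> {x xp} xk xp.
pose c := cohomology_grading R Y (padic p) k.
have /choice[y yP] : forall n, exists y, c y = y /\ x' = y *+ p ^ n.
  move=> n; have [y xy] := xp n; exists (c y); split.
    by rewrite /c component_component eqxx.
  by rewrite -componentMn -xy xk.
(* The difference of [y (d + i)] and [y (d + i.+1) *+ p] is killed by [p ^ (d + i)], hence already
   by [p ^ d]. *)
pose X i := y (d + i)%N *+ p ^ d.
have Xk i : c (X i) = X i.
  by rewrite /c componentMn; congr (_ *+ _); have [] := yP (d + i)%N.
have XS i : X i = X i.+1 *+ p.
  apply/subr0_eq; rewrite /X mulrnAC -mulrnBl; apply: torsion; exists (d + i)%N.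
  rewrite mulrnBl -mulrnA -expnS -addnS.
  by have [_ <-] := yP (d + i.+1)%N; have [_ <-] := yP (d + i)%N; rewrite subrr.
have xX : x' = X 0%N by have [_ ->] := yP d; rewrite /X addn0.
have [z zP] := choice (fun i => homogeneous_cclass (Xk i)).
have dz i : coboundary (z i) = 0 by have [] := zP i.
have zk i : cochain_component k (z i) = z i by have [] := zP i.
have zX i : cclass (z i) = X i by have [] := zP i.
have /choice[w wP] : forall i, exists w, z i - z i.+1 *+ p = coboundary w /\
    forall n (s : sing n), (k < n)%N -> w n s = 0.
  move=> i.
  have [u zu] : exists u, z i - z i.+1 *+ p = coboundary u.
    apply/cclass_eq; rewrite ?coboundaryMn ?dz ?mul0rn //.
    by rewrite cclassMn // !zX.
  suff zk' : cochain_component k (z i - z i.+1 *+ p) = z i - z i.+1 *+ p.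
    by have [w zw wk] := homogeneous_coboundary zk' zu; exists w.
  apply: cochain_eq => n s; have := congr1 (fun b : Cp => b n s) (zk i).
  have := congr1 (fun b : Cp => b n s) (zk i.+1).
  rewrite /= cochainMn; case: ifP => // _ <- <-.
  by rewrite mul0rn subr0.
have [i n s kn|t tE] := @cochain_series w k.+1; first by have [_ ->] := wP i.
have : forall i, z i - coboundary (t i) = 0.
  apply: shift_separated => i; have [wE _] := wP i.
  rewrite {1}tE coboundaryD -wE coboundaryMn opprD opprB addrA addrCA subrr
    addr0.
  by rewrite mulrnBl.
move=> /(_ 0%N) z0; rewrite xX -zX -(cclass0 R Y (padic p)).
apply/cclass_eq; rewrite ?coboundary0 //; exists (t 0%N).
by rewrite subr0; apply: subr0_eq.
Qed.

(** Lift a primitive of the reduced cocycle and subtract its coboundary: the result reduces to 0 and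
    is p times a cocycle. *)
Lemma ker_reduction (x : Hp) : r x = 0 -> exists y, x = y *+ p.
Proof.
have [a da <-] := cclassP x; rewrite /r /= coefficient_mapE // => ra.
have [u au] : exists u, red a - 0 = coboundary u.
  by apply/cclass_eq; rewrite ?coboundary0 ?cocycle_map // cclass0.
have [u' uu'] := cochain_lift u.
have [|v av] := @red_eq0 (a - coboundary u').
  by rewrite redB /red -coboundary_map -/(red u') uu' -au subr0 subrr.
have dv : coboundary v = 0.
  apply: (@padic_cochain_torsion_free 1).
  by rewrite expn1 -coboundaryMn -av coboundaryB da coboundary_coboundary subrr.
exists (cclass v); rewrite -cclassMn // -av; apply/cclass_eq => //.
  by rewrite coboundaryB da coboundary_coboundary subrr.
by exists u'; rewrite subKr.
Qed.

(** A cochain of degree 0 is a cocycle when its values at the two ends of every edge agree, and any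
    lift of values preserves such equalities, additive or not. *)
Lemma degree0_reduction (x : HF) : exists a, r a = cohomology_grading R Y 'F_p
  0%N x.
Proof.
have [|a [da a0 <-]] := @homogeneous_cclass R Y 'F_p 0%N
  (cohomology_grading R Y 'F_p 0%N x); first by rewrite component_component.
have lift0 : exists N, forall n, (N <= n)%N ->
    forall s : sing n, (if n == 0%N then padic_lift (a n s) else 0) = 0.
  by exists 1%N => -[].
pose b : Cp := Cochains lift0.
have db : coboundary b = 0.
  apply: cochain_eq => -[|[|n]] s //=; last by apply: big1 => j _;
    rewrite mulr0.
  have := congr1 (fun c : CF => c 1%N s) da;
    rewrite /= !big_ord_recl !big_ord0 /=.
  rewrite !expr0 !expr1 !mul1r !addr0 !mulN1r => /subr0_eq ->.
  exact: subrr.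
exists (cclass b); rewrite /r /= coefficient_mapE //; congr cclass.
apply: cochain_eq => n s; rewrite -[in RHS]a0 /=; case: eqP => _.
  exact: padic_liftK.
exact: rmorph0.
Qed.

Lemma redD (a b : Cp) : red (a + b) = red a + red b.
Proof. by apply: cochain_eq => n s /=; rewrite rmorphD. Qed.

Lemma charp (x : HF) : x *+ p = 0.
Proof.
have [a da <-] := cclassP x; rewrite -cclassMn // (_ : a *+ p = 0) ?cclass0 //.
apply: cochain_eq => n s; rewrite cochainMn.
exact: mulrn_pchar (pchar_Fp p_prime) _.
Qed.

Lemma bockstein_cocycle (w v : Cp) : coboundary w = v *+ p ->
  coboundary (red w) = 0 /\ coboundary v = 0.
Proof.
move=> wv; split.
  by rewrite coboundary_map wv; apply: red_p.
by apply: (@cocycle_divided 1 v w); rewrite expn1.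
Qed.

(** The derivative of [w ^+ n] when [w] has derivative [v], for the signed Leibniz rule; [w] may be
    inhomogeneous. *)
Fixpoint leibniz (v w : Cp) n : Cp :=
  if n is m.+1 then v * w ^+ m + cochain_sign w * leibniz v w m else 0.

Lemma coboundaryX (v w : Cp) q n : coboundary w = v *+ q ->
  coboundary (w ^+ n) = leibniz v w n *+ q.
Proof.
move=> wv; elim: n => [|n IH] /=; first by rewrite coboundary1 mul0rn.
by rewrite exprS coboundary_cup wv IH mulrnDl mulrnAl mulrnAr.
Qed.

Lemma sign_even_class d (b : CF) : coboundary b = 0 ->
  cohomology_grading R Y 'F_p (2 * d)%N (cclass b) = cclass b ->
  cclass (cochain_sign b) = cclass b.
Proof.
move=> db bd; have S := sign_cohomological R Y 'F_p.
rewrite -(cohomology_mapE S) //.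
have [c [dc cd <-]] := homogeneous_cclass bd.
rewrite (cohomology_mapE S) //; congr cclass; apply: cochain_eq => n s /=.
have [nd|nd] := eqVneq n (2 * d)%N; last first.
  by rewrite -cd /= (negPf nd) mulr0.
have -> : (-1) ^+ n = 1 :> 'F_p by rewrite -signr_odd nd mul2n odd_double.
exact: mul1r.
Qed.

(** By induction [x ^+ (p ^ k)] has a lift [w] whose coboundary is divisible by [p ^ k.+1]: passing
    to [w ^+ p], the derivative is a multiple of p in cohomology modulo p, and correcting by its
    primitive gains one factor p. At [k = d] the torsion bound turns the lift into a cocycle. *)
Lemma lift_power d e (x : HF) : (forall y, GRing.comm y x) ->
  cohomology_grading R Y 'F_p (2 * e)%N x = x ->
  (forall y : Hp, (exists k, y *+ p ^ k = 0) -> y *+ p ^ d = 0) ->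
  exists t, r t = x ^+ (p ^ d).
Proof.
move=> xC xe torsion.
have xke k : cohomology_grading R Y 'F_p (2 * (k * e))%N (x ^+ k) = x ^+ k.
  by rewrite mulnCA; apply: component_exp.
have divided k : exists w v, [/\ coboundary w = v *+ p ^ k.+1,
    coboundary (red w) = 0 & cclass (red w) = x ^+ (p ^ k)].
  have dred w v m : coboundary w = v *+ p ^ m.+1 -> coboundary (red w) = 0.
    by move=> wv; rewrite coboundary_map wv; apply: red_Mp.
  elim: k => [|k [w [v [wv dw wx]]]].
    have [b db bx] := cclassP x; have [w wb] := cochain_lift b.
    have [|v wv] := @red_eq0 (coboundary w).
      by rewrite /red -coboundary_map -/(red w) wb.
    by exists w, v; rewrite wb.
  have dv := cocycle_divided wv; have drv := cocycle_map (@padic_red p) dv.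
  set X := x ^+ (p ^ k) in wx; set V := cclass (red v).
  have XC y : y * X = X * y by apply: commrX.
  have dwn n : coboundary (red (w ^+ n)) = 0.
    by apply: (dred _ (leibniz v w n) k); apply: coboundaryX.
  have wn n : cclass (red (w ^+ n)) = X ^+ n.
    elim: n => [|n IH]; first by rewrite /red cochain_map1 cclass1.
    by rewrite /red !exprS cochain_mapM cclassM //; congr (_ * _).
  have sw : cclass (cochain_sign (red w)) = X.
    by rewrite (@sign_even_class (p ^ k * e)) // wx.
  have dsw : coboundary (cochain_sign (red w)) = 0.
    by have [_ + _] := sign_cohomological R Y 'F_p; apply.
  (* Since [X] is central of even degree, all terms of the derivative agree and give [n] times
     [V * X ^+ n.-1], which vanishes for [n = p]. *)
  have Ln n : coboundary (red (leibniz v w n)) = 0 /\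
      cclass (red (leibniz v w n)) = V * X ^+ n.-1 *+ n.
    elim: n => [|n [dL LE]].
      by rewrite /red cochain_map0 coboundary0 cclass0.
    have -> : red (leibniz v w n.+1) = red v * red (w ^+ n) +
        cochain_sign (red w) * red (leibniz v w n).
      by rewrite /= redD /red sign_map !cochain_mapM.
    have dvw := cocycleM drv (dwn n); have dsL := cocycleM dsw dL.
    split; first by rewrite coboundaryD dvw dsL addr0.
    rewrite cclassD // !cclassM // wn sw LE -/V mulrnAr mulrA -XC -mulrA -exprS.
    by case: (n) => [|m] /=; rewrite ?mulr0n ?addr0 ?mulr1n // -mulrS.
  have [dL LE] := Ln p.
  have [u' Lu] : exists u, red (leibniz v w p) - 0 = coboundary u.
    by apply/cclass_eq; rewrite ?coboundary0 // LE charp cclass0.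
  have [u uu'] := cochain_lift u'.
  have [|v' Lv] := @red_eq0 (leibniz v w p - coboundary u).
    by rewrite redB /red -coboundary_map -/(red u) uu' -Lu subr0 subrr.
  exists (w ^+ p - u *+ p ^ k.+1), v'.
  have wE : coboundary (w ^+ p - u *+ p ^ k.+1) = v' *+ p ^ k.+2.
    rewrite coboundaryB (coboundaryX p wv) coboundaryMn -mulrnBl Lv -mulrnA.
    by rewrite -expnS.
  have rE : red (w ^+ p - u *+ p ^ k.+1) = red (w ^+ p).
    by rewrite redB red_Mp subr0.
  by rewrite wE rE dwn wn -exprM -expnSr.
have [w [v [wv dw wx]]] := divided d.
have dv := cocycle_divided wv.
(* [v *+ p ^ d.+1] is the coboundary of [w], so the class of [v] is torsion and [p ^ d] kills it;
   then [w - u *+ p] is a cocycle with the same reduction as [w]. *)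
have [u vu] : exists u, v *+ p ^ d - 0 = coboundary u.
  apply/cclass_eq; rewrite ?coboundary0 ?coboundaryMn ?dv ?mul0rn //.
  rewrite cclass0 cclassMn //; apply: torsion; exists d.+1.
  rewrite -cclassMn // -(cclass0 R Y (padic p)).
  apply/cclass_eq; rewrite ?coboundary0 ?coboundaryMn ?dv ?mul0rn //.
  by exists w; rewrite subr0.
have dwu : coboundary (w - u *+ p) = 0.
  by rewrite coboundaryB coboundaryMn -vu wv subr0 -mulrnA -expnSr subrr.
exists (cclass (w - u *+ p)); rewrite /r /= coefficient_mapE // -wx;
  congr cclass.
by rewrite -[LHS]/(red _) redB red_p subr0.
Qed.

Lemma padic_noetherian : left_noetherian HF -> bounded_torsion p Hp ->
  left_noetherian Hp.
Proof.
move=> HF_noeth torsion; have [d dP] := torsion.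
apply: (@left_noetherian_graded _ (cohomology_grading R Y (padic p)) p).
- apply: (@rel_noetherian_mod _ _ r _ (cohomology_grading R Y 'F_p)
    _ _ _ _ (p ^ d)%N) => //.
  + exact: coefficient_map_component.
  + exact: cohomology_commutative.
  + exact: degree0_reduction.
  + by rewrite expn_gt0 prime_gt0.
  (* [lift_power] is applied to [x ^+ 2], which is central and of even degree. *)
  + move=> x hx; have [e xe] := hx; rewrite exprM.
    apply: (lift_power (e := e) _ _ dP).
      by move=> y; apply: (sqr_central (@cohomology_commutative R Y 'F_p)).
    exact: component_exp.
  + exact: ker_reduction.
- exact: cohomology_complete.
- by move=> x; apply: cohomology_separated.
Qed.

(** The relation is the Bockstein: lift a cocycle and divide the coboundary of the lift by p. It is
    linear up to the sign automorphism because [coboundary (c * w)] equals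
    [cochain_sign c * coboundary w] for a cocycle [c]. *)
Lemma mod_p_noetherian : left_noetherian Hp -> left_noetherian HF.
Proof.
have S := sign_cohomological R Y (padic p).
have [_ dS _] := S.
apply: (left_noetherian_bockstein (r := r)
  (sigma := cohomology_map (@cochain_sign R Y (padic p)))
  (beta := fun b a => exists w v, [/\ coboundary w = v *+ p,
    cclass (red w) = b & cclass v = a])).
- move=> x; have [a da <-] := cclassP x; exists (cclass (cochain_sign a)).
  by rewrite (cohomology_mapE S) ?cochain_signK //; apply: dS.
- move=> x; have [b db <-] := cclassP x; have [w wb] := cochain_lift b.
  have [|v wv] := @red_eq0 (coboundary w).
    by rewrite /red -coboundary_map -/(red w) wb.
  by exists (cclass v), w, v; rewrite wb.
- move=> b b' a a' [w [v [wv <- <-]]] [w' [v' [wv' <- <-]]].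
  have dw := bockstein_cocycle wv; have dw' := bockstein_cocycle wv'.
  exists (w - w'), (v - v'); split.
  + by rewrite coboundaryB wv wv' mulrnBl.
  + by rewrite /red cochain_mapB cclassB //; [case: dw | case: dw'].
  + by rewrite cclassB //; [case: dw | case: dw'].
- move=> x b a [w [v [wv <- <-]]]; have [c dc <-] := cclassP x.
  have [dw dv] := bockstein_cocycle wv.
  exists (c * w), (cochain_sign c * v); split.
  + by rewrite coboundary_cup dc mul0r add0r wv mulrnAr.
  + rewrite /r /= coefficient_mapE // /red cochain_mapM cclassM //.
    exact: cocycle_map.
  + by rewrite (cohomology_mapE S) // cclassM //; apply: dS.
- move=> b [w [v [wv <- v0]]]; have [dw dv] := bockstein_cocycle wv.
  have [u vu] : exists u, v - 0 = coboundary u.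
    by apply/cclass_eq; rewrite ?coboundary0 // v0 cclass0.
  have dwu : coboundary (w - u *+ p) = 0.
    by rewrite coboundaryB coboundaryMn -vu wv subr0 subrr.
  exists (cclass (w - u *+ p)); rewrite /r /= coefficient_mapE //; congr cclass.
  by rewrite -[LHS]/(red _) redB red_p subr0.
Qed.
End PadicCohomology.

Theorem theorem2p4 (R : realType) (p : nat) (p_prime : prime p)
    (Y : topologicalType) (Y_connected : path_connected R Y)
    (y0 : Y) (pi1_finite : finite_set (fundamental_group R y0)) :
  noetherian (cohomology R Y (padic p)) <->
  noetherian (cohomology R Y 'F_p) /\
  bounded_torsion p (cohomology R Y (padic p)).
Proof.
rewrite !noetherian_cohomology; split=> [Hn|[Hn]]; last exact: padic_noetherian.
by split; [exact: mod_p_noetherian | exact: bounded_torsion_noetherian].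
Qed.
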